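(* Let $1\le m\le n-1$ be integers, let $S\subset\mathbb R^n$, let $\mathbf W_0:S\to\mathbb G(n,m)$ be Lipschitzian, put $\mathbf W(x)=x+\mathbf W_0(x)$ for $x\in S$, and let $A\subset S$ be Borel measurable. The following are equivalent. (1) $\mathcal L^n(A)=0$. (2) For $\mathcal L^n$-almost every $x\in A$, $\mathcal H^m(A\cap\mathbf W(x))=0$. (3) For $\mathcal L^n$-almost every $x\in S$, $\mathcal H^m(A\cap\mathbf W(x))=0$.
   Context: $\mathbb G(n,m)$ is the set of $m$-dimensional vector subspaces of $\mathbb R^n$, with the metric $d(W_1,W_2)=\|P_{W_1}-P_{W_2}\|$ (operator norm), where $P_W$ is the orthogonal projection of $\mathbb R^n$ onto $W$. $\mathcal L^n$ is Lebesgue outer measure and $\mathcal H^m$ is $m$-dimensional Hausdorff outer measure. ''For $\mathcal L^n$-almost every $x\in S$'' means that the set of exceptional $x\in S$ has zero Lebesgue outer measure ($S$ is an arbitrary set). *)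

(* Defs.v *)
From HB Require Import structures.
From mathcomp Require Import all_boot all_order all_algebra sesquilinear.
From mathcomp Require Import all_classical all_reals all_analysis.

Set Implicit Arguments.
Unset Strict Implicit.
Unset Printing Implicit Defensive.

Import Order.TTheory GRing.Theory Num.Theory.
Import numFieldNormedType.Exports.

Local Open Scope classical_set_scope.
Local Open Scope ring_scope.

Section DotProduct.
Context {R : realType} {n : nat}.
Implicit Types u v : 'rV[R]_n.

Definition dotr u v : R := \sum_(i < n) u 0 i * v 0 i.

Fact dotr_bilinear : bilinear_for
  (GRing.Scale.Law.clone _ _ *%R _)
  (GRing.Scale.Law.clone _ _ (@idfun R \; *%R) _) dotr.
Proof.
split=> [u'|u'] a u v /=; rewrite /dotr mulr_sumr -big_split /=;
  by apply: eq_bigr => i _; rewrite !mxE ?mulrDl ?mulrDr ?mulrA // (mulrC _ a).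
Qed.

HB.instance Definition _ := bilinear_isBilinear.Build R _ _ _
  (GRing.Scale.Law.clone _ _ *%R _)
  (GRing.Scale.Law.clone _ _ (@idfun R \; *%R) _) dotr dotr_bilinear.

Fact dotr_hermitian u v : dotr u v = (-1) ^+ false * @idfun R (dotr v u).
Proof. by rewrite mul1r; apply: eq_bigr => i _; rewrite mulrC. Qed.

HB.instance Definition _ :=
  isHermitianSesquilinear.Build R _ false idfun dotr dotr_hermitian.

End DotProduct.

Section Euclidean.
Context {R : realType} {n : nat}.
Implicit Types (x y : 'rV[R]_n) (V W : {vspace 'rV[R]_n}).

(* The library norm `|x| on 'rV[R]_n is the sup norm: it induces the same
   topology, but it is not the Euclidean norm. *)
Definition enorm x : R := Num.sqrt (dotr x x).

Definition grassmannian (m : nat) : set {vspace 'rV[R]_n} :=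
  [set W | \dim W = m].

Definition orthproj W : 'End('rV[R]_n) := daddv_pi W (orthov dotr W).

Definition opnorm (f : 'End('rV[R]_n)) : R :=
  sup [set enorm (f x) | x in [set x | enorm x <= 1]].

Definition gdist V W : R := opnorm (orthproj V - orthproj W).

Definition glipschitz (S : set 'rV[R]_n)
    (W0 : 'rV[R]_n -> {vspace 'rV[R]_n}) : Prop :=
  exists K : R, forall x y, S x -> S y ->
    gdist (W0 x) (W0 y) <= K * enorm (x - y).

Definition affine_at x W : set 'rV[R]_n :=
  [set x + w | w in [set w | w \in W]].

Definition borel : set (set 'rV[R]_n) := <<s [set U : set 'rV[R]_n | open U] >>.

Definition box (a b : 'rV[R]_n) : set 'rV[R]_n :=
  [set x | forall i, a 0 i <= x 0 i <= b 0 i].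

(* The maximum gives volume 0 to an empty box [a, b] when 0 < n. *)
Definition box_volume (a b : 'rV[R]_n) : R :=
  \prod_(i < n) Num.max 0 (b 0 i - a 0 i).

(* Covers are indexed by arbitrary D : set nat, so that finite and empty
   covers are allowed also for n = 0, where every box is a point of volume 1. *)
Definition lebesgue_outer (A : set 'rV[R]_n) : \bar R :=
  ereal_inf [set r | exists (D : set nat) (a b : nat -> 'rV[R]_n),
    A `<=` \bigcup_(k in D) box (a k) (b k) /\
    r = \esum_(k in D) (box_volume (a k) (b k))%:E].

Definition ae_on (A : set 'rV[R]_n) (P : 'rV[R]_n -> Prop) : Prop :=
  lebesgue_outer [set x | A x /\ ~ P x] = 0%E.

(* -oo on the empty set. *)
Definition ediam (E : set 'rV[R]_n) : \bar R :=
  ereal_sup [set (enorm (x - y))%:E | x in E & y in E].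

End Euclidean.

Section Hausdorff.
Context {R : realType} {n : nat}.
Implicit Types (A E : set 'rV[R]_n).

Local Open Scope ereal_scope.

Definition unit_ball_volume (m : nat) : \bar R :=
  lebesgue_outer [set x : 'rV[R]_m | (enorm x <= 1)%R].

Definition hausdorff_gauge (m : nat) E : \bar R :=
  if E == set0 then 0
  else unit_ball_volume m * (ediam E * (2^-1)%:E) ^+ m.

Definition hausdorff_delta (m : nat) (d : R) A : \bar R :=
  ereal_inf [set \sum_(k <oo) hausdorff_gauge m (E k) |
    E in [set E : nat -> set 'rV[R]_n |
      A `<=` \bigcup_k E k /\ forall k, ediam (E k) <= d%:E]].

(* hausdorff_delta is nonincreasing in d, so the supremum is the limit
   as d tends to 0. *)
Definition hausdorff (m : nat) A : \bar R :=
  ereal_sup [set hausdorff_delta m d A | d in [set d : R | (0 < d)%R]].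

End Hausdorff.

(* Main.v *)
(* Over S, the planes are x + {t w(x) | t in R^m} for one of finitely many Lipschitz
   matrix fields w, whose rows are images of basis vectors under the orthogonal
   projections. So H^m(A n W(x)) = 0 means that {t | x + t w(x) in A} is Lebesgue
   null, and Fubini in (x, t) compares A with its preimages under
   phi_t(x) = x + t w(x).
   If A is null: by Rademacher's theorem w is differentiable at almost every x, and
   det(D phi_t(x)) is, along each ray of parameters t, a polynomial with value 1
   at t = 0, hence nonzero for almost every t. There phi_t is expanding at x at some
   scale, and sets on which phi_t is expanding have null preimages of null sets.
   Conversely, for all small t the map phi_t is expanding and moves bounded sets
   little. If A were non-null, choose an open U containing A with U \ A small:
   phi_t maps most of A into U, so it maps a non-null part of A into A; this for all
   small t contradicts Fubini if almost every section of A is null.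
   Rademacher's theorem is deduced from the one-dimensional case by nonporosity:
   almost every x in a Borel set F has points of F within o(|h|) of x + h. *)

Require Import Defs.
From HB Require Import structures.
From mathcomp Require Import all_boot all_order all_algebra.
From mathcomp Require Import all_classical all_reals all_analysis.
From mathcomp Require Import measurable_realfun ring lra.

Set Implicit Arguments.
Unset Strict Implicit.
Unset Printing Implicit Defensive.

Import Order.TTheory GRing.Theory Num.Theory.
Import numFieldNormedType.Exports.

Local Open Scope classical_set_scope.
Local Open Scope ring_scope.

(** The set [S] is arbitrary and the planes exist only over it, so nothing built from them need be
    measurable. McShane's extension makes each frame field [w] Lipschitz on the whole space; then
    phi_t(x) is jointly Borel in (t, x), as Fubini requires, and [w] can be differentiated almost
    everywhere. A fixed choice of m basis vectors may project to dependent vectors on some planes,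
    hence the finitely many fields; this is harmless because both directions pass to countable
    unions of null sets. The two directions differ in the parameters that they face. From a null [A]
    to null sections, the whole plane counts: for large t the map phi_t may be degenerate, and the
    differential is what singles out the bad t. In the converse a small cube of parameters is
    enough, and there the Lipschitz bound of [w] alone makes phi_t expanding with constant 2.
    Measures are compared only up to constant factors. So covers by cubes replace the area formula,
    and the sup norm stands in for the Euclidean one at the cost of a dimensional factor. *)

Section norms.
Context {R : realType}.

Lemma ler_entry_norm m n (x : 'M[R]_(m, n)) i j : `|x i j| <= `|x|.
Proof.
rewrite [leRHS]mx_normrE.
exact: (le_bigmax _ (fun ij : 'I_m * 'I_n => `|x ij.1 ij.2|) (i, j)).
Qed.

Lemma mx_norm_le m n (x : 'M[R]_(m, n)) c : 0 <= c ->
  (forall i j, `|x i j| <= c) -> `|x| <= c.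
Proof.
move=> c0 xc; rewrite [leLHS]mx_normrE.
by apply/bigmax_leP; split => // -[i j] _; exact: xc.
Qed.

Lemma mx_norm_lt m n (x : 'M[R]_(m, n)) c : 0 < c ->
  (forall i j, `|x i j| < c) -> `|x| < c.
Proof.
move=> c0 xc; rewrite [ltLHS]mx_normrE.
by apply/bigmax_ltP; split => // -[i j] _; exact: xc.
Qed.

Lemma rV_ballE n (x y : 'rV[R]_n) e : ball x e y = (`|x - y| < e).
Proof. by rewrite mx_norm_ball. Qed.

Lemma norm_delta_mx_le m n i j : `|delta_mx i j : 'M[R]_(m, n)| <= 1.
Proof.
apply: mx_norm_le => // k l; rewrite mxE.
by case: (_ && _); rewrite ?normr0 ?normr1.
Qed.

Lemma norm_mulmx_le m n p (x : 'M[R]_(m, n)) (y : 'M[R]_(n, p)) :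
  `|x *m y| <= n%:R * `|x| * `|y|.
Proof.
apply: mx_norm_le => [|i k]; first by rewrite !mulr_ge0.
rewrite mxE (le_trans (ler_norm_sum _ _ _))//.
rewrite (le_trans (y := \sum_(j < n) `|x| * `|y|))//.
  apply: ler_sum => j _; rewrite normrM.
  by rewrite ler_pM// ler_entry_norm.
by rewrite sumr_const card_ord -[leLHS]mulr_natl mulrA.
Qed.

End norms.

(** * Lebesgue outer measure on Borel sets *)

Section outer_measure.
Context {R : realType} {n : nat}.
Implicit Types (A : set 'rV[R]_n) (a b x : 'rV[R]_n).
Local Open Scope ereal_scope.

Lemma box_volume_ge0 a b : (0 <= box_volume a b)%R.
Proof. by apply: prodr_ge0 => i _; rewrite le_max lexx. Qed.

Lemma box_volumee_ge0 a b : 0 <= (box_volume a b)%:E.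
Proof. by rewrite lee_fin box_volume_ge0. Qed.

(** Any countable index type may serve, through [pickle]; double covers and finite grids are then
    used without renumbering. *)
Lemma lebesgue_outer_le_esum (I : countType) (J : set I) (a b : I -> 'rV[R]_n) A :
  A `<=` \bigcup_(i in J) box (a i) (b i) ->
  lebesgue_outer A <= \esum_(i in J) (box_volume (a i) (b i))%:E.
Proof.
move=> AJ; apply: ereal_inf_lbound.
pose ext (f : I -> 'rV[R]_n) k := if @unpickle I k is Some i then f i else 0%R.
have extE f i : ext f (pickle i) = f i by rewrite /ext pickleK.
exists (@pickle I @` J), (ext a), (ext b); split.
  move=> x /AJ[i Ji xi]; exists (pickle i); first by exists i.
  by rewrite !extE.
rewrite (reindex_esum J _ (@pickle I)).
  by apply: eq_esum => i _; rewrite !extE.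
by apply: inj_bij => i j _ _ /(pcan_inj pickleK).
Qed.

Lemma lebesgue_outer_cover A (c : \bar R) : lebesgue_outer A < c ->
  exists (D : set nat) (a b : nat -> 'rV[R]_n),
    A `<=` \bigcup_(k in D) box (a k) (b k) /\
    \esum_(k in D) (box_volume (a k) (b k))%:E < c.
Proof. by move=> /ereal_inf_lt[_ [D [a [b [AD ->]]]] ?]; exists D, a, b. Qed.

Lemma lebesgue_outer_ge0 A : 0 <= lebesgue_outer A.
Proof.
apply: le_ereal_inf_tmp => _ [D [a [b [_ ->]]]].
by apply: esum_ge0 => k _; exact: box_volumee_ge0.
Qed.

Lemma lebesgue_outer0 : lebesgue_outer (@set0 'rV[R]_n) = 0.
Proof.
apply/eqP; rewrite eq_le lebesgue_outer_ge0 andbT.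
have := @lebesgue_outer_le_esum nat set0 (fun=> 0%R) (fun=> 0%R) set0.
by rewrite esum_set0; apply; exact: sub0set.
Qed.

Lemma le_lebesgue_outer : {homo @lebesgue_outer R n : A B / A `<=` B >-> A <= B}.
Proof.
move=> A B AB; apply: ereal_inf_le_tmp => _ [D [a [b [BD ->]]]].
by exists D, a, b; split => //; exact: subset_trans BD.
Qed.

Lemma lebesgue_outer_sigma_subadditive : sigma_subadditive (@lebesgue_outer R n).
Proof.
move=> F; have [[i ioo]|] := pselect (exists i, lebesgue_outer (F i) = +oo).
  rewrite (eseries_pinfty _ _ ioo) ?leey// => k _.
  by rewrite -ltNye (lt_le_trans _ (lebesgue_outer_ge0 _)).
rewrite -forallNE => Foo.
apply/lee_addgt0Pr => e e0.
rewrite (le_trans _ (epsilon_trick _ _ (ltW e0)))//; last first.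
  by move=> k; exact: lebesgue_outer_ge0.
pose P i (c : set nat * (nat -> 'rV[R]_n) * (nat -> 'rV[R]_n)) :=
  F i `<=` \bigcup_(k in c.1.1) box (c.1.2 k) (c.2 k) /\
  \esum_(k in c.1.1) (box_volume (c.1.2 k) (c.2 k))%:E <=
    lebesgue_outer (F i) + (e / (2 ^ i.+1)%:R)%:E.
have [c Pc] : {c & forall i, P i (c i)}.
  apply: (@choice _ _ P) => i.
  have /lebesgue_outer_cover[D [a [b [FD Dlt]]]] : lebesgue_outer (F i) <
      lebesgue_outer (F i) + (e / (2 ^ i.+1)%:R)%:E.
    rewrite lteDl ?lte_fin ?divr_gt0// ?ltr0n ?expn_gt0//.
    by rewrite ge0_fin_numE ?lebesgue_outer_ge0// ltey; exact/eqP.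
  by exists (D, a, b); split => //=; exact: ltW.
apply: (@le_trans _ _ (\esum_(k in [set: nat] `*`` (fun i => (c i).1.1))
   (box_volume ((c k.1).1.2 k.2) ((c k.1).2 k.2))%:E)).
  apply: lebesgue_outer_le_esum => x [i _ Fx].
  by have [/(_ _ Fx)[k ck xk] _] := Pc i; exists (i, k).
rewrite -(esum_esum (a := fun i k => (box_volume ((c i).1.2 k) ((c i).2 k))%:E)).
  2: by move=> i k _ _; exact: box_volumee_ge0.
rewrite nneseries_esumT; last first.
  move=> i; rewrite adde_ge0 ?lebesgue_outer_ge0// lee_fin divr_ge0//.
  exact: ltW.
by apply: le_esum => i _; exact: (Pc i).2.
Qed.

HB.instance Definition _ := isOuterMeasure.Build R 'rV[R]_n (@lebesgue_outer R n)
  lebesgue_outer0 lebesgue_outer_ge0 le_lebesgue_outer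
  lebesgue_outer_sigma_subadditive.

Lemma lebesgue_outer_box_le a b : lebesgue_outer (box a b) <= (box_volume a b)%:E.
Proof.
have := @lebesgue_outer_le_esum unit setT (fun=> a) (fun=> b) (box a b).
rewrite (_ : [set: unit] = [set tt]); last by apply/seteqP; split => // -[].
rewrite esum_set1 ?box_volumee_ge0//; apply.
by move=> x ?; exists tt.
Qed.

Lemma lebesgue_outer_null_bigcup (F : nat -> set 'rV[R]_n) :
  (forall k, lebesgue_outer (F k) = 0) -> lebesgue_outer (\bigcup_k F k) = 0.
Proof.
move=> F0; apply/eqP; rewrite eq_le lebesgue_outer_ge0 andbT.
apply: (le_trans (lebesgue_outer_sigma_subadditive F)).
by rewrite eseries0.
Qed.

Lemma lebesgue_outer_null_countable (I : countType) (F : I -> set 'rV[R]_n) :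
  (forall i, lebesgue_outer (F i) = 0) -> lebesgue_outer (\bigcup_i F i) = 0.
Proof.
move=> F0; apply/eqP; rewrite eq_le lebesgue_outer_ge0 andbT.
pose G k := if @unpickle I k is Some i then F i else set0.
have <- : lebesgue_outer (\bigcup_k G k) = 0.
  apply: lebesgue_outer_null_bigcup => k; rewrite /G; case: unpickle => [i|].
    exact: F0.
  exact: lebesgue_outer0.
apply: le_lebesgue_outer => x [i _ Fx]; exists (pickle i) => //.
by rewrite /G pickleK.
Qed.

Lemma lebesgue_outer_nullS A B :
  A `<=` B -> lebesgue_outer B = 0 -> lebesgue_outer A = 0.
Proof.
move=> AB B0; apply/eqP; rewrite eq_le lebesgue_outer_ge0 andbT -B0.
exact: le_lebesgue_outer.
Qed.

Lemma lebesgue_outer_nullU A B :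
  lebesgue_outer A = 0 -> lebesgue_outer B = 0 -> lebesgue_outer (A `|` B) = 0.
Proof.
move=> A0 B0; apply: (@lebesgue_outer_nullS _ (\bigcup_(b : bool) if b then A else B)).
  by move=> x [|] ?; [exists true|exists false].
by apply: lebesgue_outer_null_countable => -[].
Qed.

End outer_measure.

Section borel_measure.
Context {R : realType} {n : nat}.
Local Open Scope ereal_scope.
Implicit Types (A : set 'rV[R]_n) (a b x : 'rV[R]_n).

(* Cutting a box by a coordinate hyperplane splits its volume exactly. *)
Lemma halfspace_caratheodory (i : 'I_n) (c : R) :
  (@lebesgue_outer R n).-caratheodory [set x | (x 0%R i <= c)%R].
Proof.
apply: le_caratheodory_measurable => X.
change (lebesgue_outer (X `&` [set x | (x 0%R i <= c)%R]) +
  lebesgue_outer (X `&` ~` [set x | (x 0%R i <= c)%R]) <= lebesgue_outer X).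
have [->|Xoo] := eqVneq (lebesgue_outer X) +oo; first by rewrite leey.
apply/lee_addgt0Pr => e e0.
have /lebesgue_outer_cover[D [a [b [XD Dlt]]]] :
    lebesgue_outer X < lebesgue_outer X + e%:E.
  by rewrite lteDl ?lte_fin// ge0_fin_numE ?lebesgue_outer_ge0// ltey.
apply: le_trans (ltW Dlt).
(* [box (a k) (b' k)] and [box (a' k) (b k)] are the two closed halves. When the hyperplane misses
   the box, one half is empty and [Num.max 0] gives it volume 0. *)
pose b' k : 'rV[R]_n := (\row_j if j == i then Num.min (b k 0 j) c else b k 0 j)%R.
pose a' k : 'rV[R]_n := (\row_j if j == i then Num.max (a k 0 j) c else a k 0 j)%R.
have volE k : box_volume (a k) (b k) =
    (box_volume (a k) (b' k) + box_volume (a' k) (b k))%R.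
  have volD u v : box_volume u v = (Num.max 0 (v 0 i - u 0 i) *
      \prod_(j < n | j != i) Num.max 0 (v 0 j - u 0 j))%R.
    by rewrite /box_volume (bigD1 i).
  rewrite !volD.
  have eqa : (\prod_(j < n | j != i) Num.max 0 (b' k 0 j - a k 0 j) =
             \prod_(j < n | j != i) Num.max 0 (b k 0 j - a k 0 j))%R.
    by apply: eq_bigr => j /negbTE ji; rewrite mxE ji.
  have eqb : (\prod_(j < n | j != i) Num.max 0 (b k 0 j - a' k 0 j) =
             \prod_(j < n | j != i) Num.max 0 (b k 0 j - a k 0 j))%R.
    by apply: eq_bigr => j /negbTE ji; rewrite mxE ji.
  rewrite eqa eqb -mulrDl !mxE eqxx; congr (_ * _)%R.
  by rewrite !maxEle !minEle; do ! case: ifPn; lra.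
under eq_esum do rewrite volE EFinD.
rewrite esumD; try by move=> *; rewrite lee_fin box_volume_ge0.
apply: leeD; apply: lebesgue_outer_le_esum => x [/XD[k Dk xk] /= xc]; exists k => // j;
  have /andP[ajx xbj] := xk j; rewrite mxE; case: eqP => [ji|]; rewrite ?ajx ?xbj//.
  by rewrite le_min xbj ji xc.
by rewrite ge_max ajx ji andbT; apply/ltW; rewrite ltNge; exact/negP.
Qed.

Definition obox a b : set 'rV[R]_n := [set x | forall i, (a 0 i < x 0 i < b 0 i)%R].

Definition ratbox (q : 'rV[rat]_n * 'rV[rat]_n) : set 'rV[R]_n :=
  obox (map_mx ratr q.1) (map_mx ratr q.2).

Lemma entry_lt_open (i : 'I_n) (c : R) : open [set x : 'rV[R]_n | (x 0%R i < c)%R].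
Proof.
apply: (@open_comp _ _ (fun x : 'rV[R]_n => x 0%R i) [set y | (y < c)%R]).
  by move=> x _; exact: coord_continuous.
exact: open_lt.
Qed.

Lemma entry_gt_open (i : 'I_n) (c : R) : open [set x : 'rV[R]_n | (c < x 0%R i)%R].
Proof.
apply: (@open_comp _ _ (fun x : 'rV[R]_n => x 0%R i) [set y | (c < y)%R]).
  by move=> x _; exact: coord_continuous.
exact: open_gt.
Qed.

Lemma obox_open a b : open (obox a b).
Proof.
rewrite (_ : obox a b = \bigcap_(i in [set` enum 'I_n])
    ([set x | (x 0 i < b 0 i)%R] `&` [set x | (a 0 i < x 0 i)%R])).
  rewrite bigcap_seq; elim/big_ind : _ => [|U V|i _]; [exact: openT|exact: openI|].
  by apply: openI; [exact: entry_lt_open|exact: entry_gt_open].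
apply/seteqP; split=> x /= xab i.
  by move=> _; have /andP[] := xab i.
by have [/=|/= -> ->] := xab i; rewrite ?mem_enum.
Qed.

(** The rational open boxes form a countable base: later unions over all points of an open set, and
    tests over all nearby points, become countable through it. *)
Lemma open_ratbox (U : set 'rV[R]_n) x : open U -> U x ->
  exists2 q, ratbox q x & ratbox q `<=` U.
Proof.
move=> oU Ux; have := open_nbhs_nbhs (conj oU Ux).
rewrite -nbhs_ballE => -[e /= e0 xeU].
have [q1 hq1] : {q : 'I_n -> rat & forall i, (x 0 i - e < ratr (q i) < x 0 i)%R}.
  apply: (@choice _ _ (fun i q => (x 0 i - e < ratr q < x 0 i)%R)) => i.
  have /rat_in_itvoo[q] : (x 0 i - e < x 0 i)%R by rewrite ltrBlDr ltrDl.
  by rewrite in_itv/= => ?; exists q.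
have [q2 hq2] : {q : 'I_n -> rat & forall i, (x 0 i < ratr (q i) < x 0 i + e)%R}.
  apply: (@choice _ _ (fun i q => (x 0 i < ratr q < x 0 i + e)%R)) => i.
  have /rat_in_itvoo[q] : (x 0 i < x 0 i + e)%R by rewrite ltrDl.
  by rewrite in_itv/= => ?; exists q.
exists (\row_i q1 i, \row_i q2 i)%R => [i|y yq].
  rewrite !mxE; have /andP[_ ->] := hq1 i.
  by have /andP[-> _] := hq2 i.
apply: xeU; rewrite rV_ballE; apply: mx_norm_lt => // i j.
rewrite !ord1 !mxE ltr_norml; move: (yq j); rewrite !mxE.
by move: (hq1 j) (hq2 j); lra.
Qed.

Lemma ratbox_bigcup (U : set 'rV[R]_n) : open U ->
  U = \bigcup_(q in [set q | ratbox q `<=` U]) ratbox q.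
Proof.
move=> oU; apply/seteqP; split=> [x Ux|x [q /= qU xq]]; last exact: qU.
by have [q qx qU] := open_ratbox oU Ux; exists q.
Qed.

Lemma bigcup_cond_setT (I T : Type) (P : set I) (F : I -> set T) :
  \bigcup_(i in P) F i = \bigcup_i (if `[<P i>] then F i else set0).
Proof.
apply/seteqP; split=> x [i].
  by move=> Pi Fi; exists i => //; case: asboolP.
by move=> _; case: asboolP => // Pi Fi; exists i.
Qed.

Lemma open_caratheodory (U : set 'rV[R]_n) : open U ->
  (@lebesgue_outer R n).-caratheodory U.
Proof.
move=> /ratbox_bigcup ->; rewrite bigcup_cond_setT.
suff mrat q : measurable (ratbox q : set (caratheodory_type (@lebesgue_outer R n))).
  apply: (@countable_bigcupT_measurable _ (caratheodory_type (@lebesgue_outer R n))).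
    exact: countableP.
  by move=> q; case: asboolP => // _; exact: measurable0.
(* Only the closed half-spaces [x 0 i <= c] are known to be Caratheodory measurable: a strict upper
   bound is a countable union of them, a strict lower bound is a complement. *)
rewrite (_ : ratbox q = \bigcap_(i in [set: 'I_n])
  (\bigcup_k [set x : 'rV[R]_n | (x 0 i <= ratr (q.2 0 i) - k.+1%:R^-1)%R] `&`
    ~` [set x : 'rV[R]_n | (x 0 i <= ratr (q.1 0 i))%R])).
  apply: fin_bigcap_measurable => [|i _]; first exact: finite_finset.
  apply: (@measurableI _ (caratheodory_type (@lebesgue_outer R n))).
    apply: (@bigcupT_measurable _ (caratheodory_type (@lebesgue_outer R n))) => k.
    exact: halfspace_caratheodory.
  apply: (@measurableC _ (caratheodory_type (@lebesgue_outer R n))).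
  exact: halfspace_caratheodory.
apply/seteqP; split=> x /= xq i.
  move=> _; move: (xq i); rewrite !mxE => /andP[qx xq2]; split; last first.
    by apply/negP; rewrite -ltNge.
  have /ltr_add_invr[k kx] := xq2.
  by exists k => //=; rewrite lerBrDr ltW.
have [[k _ /= kx] /negP] := xq i Logic.I; rewrite !mxE -ltNge => -> /=.
by rewrite (le_lt_trans kx)// ltrBlDr ltrDl.
Qed.

Lemma borel_caratheodory A : borel A -> (@lebesgue_outer R n).-caratheodory A.
Proof.
apply: smallest_sub; last exact: open_caratheodory.
exact: (@sigma_algebra_measurable _ (caratheodory_type (@lebesgue_outer R n))).
Qed.

(** A copy of the row vectors carrying the Borel sigma-algebra, so that measures, products and
    measurable functions apply. Its measurable sets are the [borel] sets by conversion. *)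
Definition rVborel := g_sigma_algebraType (@open 'rV[R]_n).

Definition lebesgue_rV (A : set rVborel) : \bar R := lebesgue_outer A.

Let lebesgue_rV0 : lebesgue_rV set0 = 0.
Proof. exact: lebesgue_outer0. Qed.

Let lebesgue_rV_ge0 A : 0 <= lebesgue_rV A.
Proof. exact: lebesgue_outer_ge0. Qed.

Let lebesgue_rV_sigma_additive : semi_sigma_additive lebesgue_rV.
Proof.
move=> F mF tF mUF.
apply: (@caratheodory_measure_sigma_additive R _ (@lebesgue_outer R n)) => //.
  by move=> k; exact: (borel_caratheodory (mF k)).
exact: (borel_caratheodory mUF).
Qed.

HB.instance Definition _ := isMeasure.Build _ _ _ lebesgue_rV
  lebesgue_rV0 lebesgue_rV_ge0 lebesgue_rV_sigma_additive.

Lemma open_measurable_rV (U : set 'rV[R]_n) : open U -> measurable (U : set rVborel).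
Proof. by move=> oU; exact: sub_sigma_algebra. Qed.

Lemma closed_measurable_rV (U : set 'rV[R]_n) :
  closed U -> measurable (U : set rVborel).
Proof.
move=> cU; rewrite -[U]setCK; apply: measurableC.
by apply: open_measurable_rV; exact: closed_openC.
Qed.

Lemma box_closed a b : closed (box a b).
Proof.
rewrite (_ : box a b = \bigcap_(i in [set: 'I_n])
    (~` [set x | (b 0 i < x 0 i)%R] `&` ~` [set x | (x 0 i < a 0 i)%R])).
  apply: closed_bigI => i _; apply: closedI; apply: open_closedC.
    exact: entry_gt_open.
  exact: entry_lt_open.
apply/seteqP; split=> x /= xab i.
  by move=> _; have /andP[? ?] := xab i; split; apply/negP; rewrite -leNgt.
by have [/negP + /negP] := xab i Logic.I; rewrite -!leNgt => -> ->.
Qed.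

Lemma bigcup_box_setT :
  [set: 'rV[R]_n] = \bigcup_k box (const_mx (- k%:R)%R) (const_mx k%:R).
Proof.
apply/seteqP; split=> // x _; exists (Num.truncn `|x|).+1 => // i.
rewrite !mxE -ler_norml (le_trans (ler_entry_norm _ _ _))//.
by apply: ltW; exact: truncnS_gt.
Qed.

Let lebesgue_rV_sigma_finite : sigma_finite setT lebesgue_rV.
Proof.
exists (fun k : nat => box (const_mx (- k%:R)%R) (const_mx k%:R)).
  exact: bigcup_box_setT.
move=> k; split; first by apply: closed_measurable_rV; exact: box_closed.
by rewrite (le_lt_trans (lebesgue_outer_box_le _ _))// ltry.
Qed.

HB.instance Definition _ := Measure_isSigmaFinite.Build _ _ _ lebesgue_rV
  lebesgue_rV_sigma_finite.

End borel_measure.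
Arguments rVborel : clear implicits.

Section box_measure.
Context {R : realType}.
Local Open Scope ereal_scope.

Lemma box_volume_cons n (a b : 'rV[R]_n.+1) :
  box_volume a b = (Num.max 0 (b 0 0 - a 0 0) *
    box_volume (\row_i a 0 (lift ord0 i)) (\row_i b 0 (lift ord0 i)))%R.
Proof.
rewrite /box_volume big_ord_recl; congr (_ * _)%R.
by apply: eq_bigr => i _; rewrite !mxE.
Qed.

(** Slicing by the first coordinate: the slice of [box a b] at [s] is covered by the tails of the
    boxes whose first side contains [s]. Induction bounds its volume by a series of indicator
    functions of [s], and integrating over the first side restores the full volumes. *)
Lemma box_volume_le_cover n (a b : 'rV[R]_n) (D : set nat) (c d : nat -> 'rV[R]_n) :
  box a b `<=` \bigcup_(k in D) box (c k) (d k) ->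
  (box_volume a b)%:E <= \esum_(k in D) (box_volume (c k) (d k))%:E.
Proof.
elim: n a b D c d => [|n IH] a b D c d abD.
  (* In dimension 0 every box is the one point and has volume 1, so a single index of the cover
     suffices. *)
  have [|k Dk _] := abD 0%R; first by case.
  apply: esum_ge; exists [set k]; first by split => // _ ->.
  by rewrite fsbig_set1 /box_volume !big_ord0.
have [ba|ab] := ltP (b 0%R 0%R) (a 0%R 0%R).
  rewrite box_volume_cons max_l; last by rewrite subr_le0 ltW.
  rewrite mul0r.
  by apply: esum_ge0 => k _; exact: box_volumee_ge0.
pose tl (v : 'rV[R]_n.+1) : 'rV[R]_n := (\row_i v 0 (lift ord0 i))%R.
pose I k : set R := `[c k 0%R 0%R, d k 0%R 0%R]%classic.
pose V := box_volume (tl a) (tl b).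
pose W k := if k \in D then box_volume (tl (c k)) (tl (d k)) else 0%R.
have W0 k : (0 <= W k)%R by rewrite /W; case: ifP => // _; exact: box_volume_ge0.
have VW s : s \in `[a 0%R 0%R, b 0%R 0%R] ->
    V%:E <= \sum_(k <oo) ((W k)%:E * (\1_(I k) s)%:E).
  rewrite in_itv/= => sab; apply: (@le_trans _ _
    (\esum_(k in D `&` [set k | I k s]) (box_volume (tl (c k)) (tl (d k)))%:E)).
    apply: IH => v vab.
    pose u : 'rV[R]_n.+1 := (\row_i if unlift ord0 i is Some j then v 0 j else s)%R.
    have [|k Dk uk] := abD u.
      move=> i; rewrite mxE; case: unliftP => [j ->|->//].
      by have := vab j; rewrite !mxE.
    exists k; last first.
      by move=> i; have := uk (lift ord0 i); rewrite !mxE liftK.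
    split => //; have := uk ord0; rewrite mxE.
    by rewrite /I/= in_itv/=; case: unliftP => // j /eqP; rewrite eq_sym (negbTE (neq_lift _ _)).
  rewrite nneseries_esumT; last first.
    by move=> k; rewrite -EFinM lee_fin mulr_ge0.
  rewrite esum_mkcond; apply: le_esum => k _.
  rewrite /W in_setI indicE; case: (k \in D) => /=; last by rewrite mul0e.
  have [Is|Is] := pselect (I k s).
    by rewrite !mem_set// mule1.
  by rewrite !memNset// mule0.
have mI k : measurable (I k) by exact: measurable_itv.
pose J := `[a 0%R 0%R, b 0%R 0%R]%classic.
have mJ : measurable J by exact: measurable_itv.
pose g k (s : R) := (W k)%:E * (\1_(I k) s)%:E.
have mInd k : measurable_fun J (fun s : R => (\1_(I k) s : R)%:E).
  by apply/measurable_EFinP; exact: measurable_indic.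
have mWI k : measurable_fun J (g k) by exact: measurable_funeM.
have g0 k s : 0 <= g k s by rewrite /g -EFinM lee_fin mulr_ge0.
have leV : \int[@lebesgue_measure R]_(s in J) (cst V%:E s) <=
    \int[@lebesgue_measure R]_(s in J) \sum_(k <oo) g k s.
  apply: ge0_le_integral => //.
  - by move=> s _; rewrite lee_fin box_volume_ge0.
  - by apply: (@ge0_emeasurable_sum _ _ _ J g xpredT).
have muJ : lebesgue_measure J = (b 0 0 - a 0 0)%:E.
  rewrite /J lebesgue_measure_itv/= lte_fin; case: ifPn => [_|]; first by rewrite -EFinB.
  rewrite -leNgt => ba; have -> : (b 0 0 = a 0 0)%R by apply/eqP; rewrite eq_le ab ba.
  by rewrite subrr.
rewrite integral_cst// integral_nneseries// in leV.
have {}leV : V%:E * (b 0 0 - a 0 0)%:E <= \sum_(k <oo) \int[@lebesgue_measure R]_(s in J) g k s.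
  by rewrite -muJ; exact: leV.
rewrite box_volume_cons max_r ?subr_ge0// mulrC.
rewrite EFinM (le_trans leV)//.
rewrite nneseries_esumT; last first.
  by move=> k; exact: integral_ge0.
rewrite [leRHS]esum_mkcond; apply: le_esum => k _.
rewrite /g ge0_integralZl//; last 2 first.
  exact: mInd.
  by rewrite lee_fin.
rewrite integral_indic; [|exact: mJ|exact: mI].
apply: (@le_trans _ _ ((W k)%:E * (Num.max 0 (d k 0 0 - c k 0 0))%:E)).
  apply: lee_wpmul2l; first by rewrite lee_fin.
  apply: (@le_trans _ _ (lebesgue_measure (I k))).
    by apply: le_measure; rewrite ?inE; [exact: (measurableI _ _ (mI k) mJ)|exact: mI|].
  rewrite /I lebesgue_measure_itv/= lte_fin; case: ifPn => h.
    by rewrite -EFinB lee_fin le_max lexx orbT.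
  by rewrite lee_fin le_max lexx.
rewrite /W; case: ifPn => _; last by rewrite mul0e.
by rewrite -EFinM lee_fin box_volume_cons mulrC.
Qed.

Lemma lebesgue_outer_box n (a b : 'rV[R]_n) :
  lebesgue_outer (box a b) = (box_volume a b)%:E.
Proof.
apply/eqP; rewrite eq_le lebesgue_outer_box_le/=.
by apply: le_ereal_inf_tmp => _ [D [c [d [abD ->]]]]; exact: box_volume_le_cover.
Qed.

Definition cube n (x : 'rV[R]_n) (r : R) : set 'rV[R]_n :=
  box (x - const_mx r)%R (x + const_mx r)%R.

Lemma cubeE n (x : 'rV[R]_n) r : (0 <= r)%R -> cube x r = [set y | (`|y - x| <= r)%R].
Proof.
move=> r0; apply/seteqP; split=> y /= yx.
  apply: mx_norm_le => // i j; rewrite ord1 !mxE ler_norml.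
  by have := yx j; rewrite !mxE; lra.
move=> i; have := le_trans (ler_entry_norm (y - x)%R 0%R i) yx.
by rewrite !mxE ler_norml; lra.
Qed.

Lemma lebesgue_outer_cube n (x : 'rV[R]_n) r : (0 <= r)%R ->
  lebesgue_outer (cube x r) = ((2 * r) ^+ n)%:E.
Proof.
move=> r0; rewrite lebesgue_outer_box /box_volume; congr EFin.
rewrite -[X in (_ ^+ X)%R]card_ord -prodr_const; apply: eq_bigr => i _.
by rewrite !mxE max_r; lra.
Qed.

End box_measure.

(** * Null sets and their sections *)

Section null_sections.
Local Open Scope ereal_scope.
Context d1 d2 (T1 : measurableType d1) (T2 : measurableType d2) (R : realType).
Variables (m1 : {sigma_finite_measure set T1 -> \bar R})
  (m2 : {sigma_finite_measure set T2 -> \bar R}).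

(** Tonelli: both hypotheses and conclusion say that [E] is null for the product measure. Uniqueness
    identifies the product built from sections in one direction with the product built from the
    other. *)
Lemma ae_null_sections_swap (E : set (T1 * T2)) : measurable E ->
  {ae m1, forall x, m2 (xsection E x) = 0} ->
  {ae m2, forall y, m1 (ysection E y) = 0}.
Proof.
move=> mE E1.
have E0 : (m1 \x^ m2) E = 0.
  rewrite -(@product_measure_unique _ _ _ _ _ m1 m2 (m1 \x^ m2))//; last first.
    by move=> A B mA mB; exact: product_measure2E.
  rewrite /product_measure1 (@ge0_ae_eq_integral _ _ _ _ _ _ (cst 0))//.
  - by rewrite integral0.
  - exact: measurable_fun_xsection.
  - by apply: filterS E1 => x + _.
have [+ _] := ae_eq_integral_abs m2 measurableT (measurable_fun_ysection m1 mE).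
have -> : \int[m2]_x `|(m1 \o ysection E) x| = 0.
  by rewrite -E0; apply: eq_integral => y _; rewrite gee0_abs.
by move=> /(_ erefl); apply: filterS => y; apply.
Qed.

End null_sections.

Section rV_measurable.
Context {R : realType}.

Lemma continuous_measurable_rV n (f : 'rV[R]_n -> R) : continuous f ->
  measurable_fun [set: rVborel R n] f.
Proof.
move=> cf; apply: (measurability _ (RGenOInfty.measurableE R)).
move=> _ [_ [a ->] <-]; rewrite setTI; apply: open_measurable_rV.
apply: open_comp => [x _|]; first exact: cf.
exact: rray_open.
Qed.

Lemma measurable_rV_entry n i : measurable_fun [set: rVborel R n] (fun x => x 0 i).
Proof. by apply: continuous_measurable_rV => x; exact: coord_continuous. Qed.

Lemma measurable_fun_rV d (T : measurableType d) n (f : T -> rVborel R n) :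
  (forall i, measurable_fun [set: T] (fun t => f t 0 i)) ->
  measurable_fun [set: T] f.
Proof.
move=> mf; apply: (@measurability _ _ T (rVborel R n) _ _ (@open 'rV[R]_n)) => //.
move=> _ [U oU <-]; rewrite setTI (ratbox_bigcup oU) bigcup_cond_setT.
rewrite preimage_bigcup; apply: countable_bigcupT_measurable.
  exact: countableP.
move=> q; case: asboolP => _; last by rewrite preimage_set0.
rewrite (_ : _ @^-1` _ = \bigcap_(i in [set: 'I_n])
    ((fun t => f t 0 i) @^-1` `](ratr (q.1 0 i)), (ratr (q.2 0 i))[)).
  apply: fin_bigcap_measurable => [|i _]; first exact: finite_finset.
  by rewrite -[X in measurable X]setTI; apply: mf => //; exact: measurable_itv.
apply/seteqP; split=> t /= tq i.
  by move=> _; have := tq i; rewrite !mxE/= in_itv.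
by have := tq i Logic.I; rewrite /= in_itv/= !mxE.
Qed.

Lemma measurable_fun_norm_rV n : measurable_fun [set: rVborel R n]
  (fun x : 'rV[R]_n => `|x|).
Proof. by apply: continuous_measurable_rV => x; exact: norm_continuous. Qed.

(** [negligible] asks for a measurable null superset; intersecting the unions of ever cheaper covers
    by closed boxes provides one. *)
Lemma lebesgue_outer_null_hull n (A : set 'rV[R]_n) : lebesgue_outer A = 0%E ->
  exists B : set 'rV[R]_n, [/\ borel B, A `<=` B & lebesgue_outer B = 0%E].
Proof.
move=> A0.
have cov j : {B : set 'rV[R]_n | [/\ borel B, A `<=` B &
    (lebesgue_outer B <= j.+1%:R^-1%:E)%E]}.
  apply: cid; have /lebesgue_outer_cover[D [a [b [AD Dlt]]]] :
      (lebesgue_outer A < j.+1%:R^-1%:E)%E by rewrite A0 lte_fin.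
  exists (\bigcup_(k in D) box (a k) (b k)); split => //.
    apply: (@bigcup_measurable _ (rVborel R n)) => k _.
    by apply: closed_measurable_rV; exact: box_closed.
  by apply: le_trans (ltW Dlt); exact: lebesgue_outer_le_esum.
exists (\bigcap_j sval (cov j)); split.
- apply: (@bigcapT_measurable _ (rVborel R n)) => j.
  by case: (svalP (cov j)).
- by move=> x Ax j _; case: (svalP (cov j)) => _ + _; apply.
- apply/eqP; rewrite eq_le lebesgue_outer_ge0 andbT.
  apply/lee_addgt0Pr => e e0; rewrite add0e.
  have [j je] : exists j, (j.+1%:R^-1 <= e).
    have /ltr_add_invr[j] := e0; rewrite add0r => /ltW ?; by exists j.
  apply: (@le_trans _ _ (lebesgue_outer (sval (cov j)))).
    by apply: le_lebesgue_outer => x; apply.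
  by case: (svalP (cov j)) => _ _ /le_trans; apply; rewrite lee_fin.
Qed.

Lemma negligible_rVP n (A : set 'rV[R]_n) :
  (@lebesgue_rV R n).-negligible A <-> lebesgue_outer A = 0%E.
Proof.
split=> [[B [mB B0 AB]]|/lebesgue_outer_null_hull[B [mB AB B0]]].
  exact: lebesgue_outer_nullS AB B0.
by exists B.
Qed.

Lemma lebesgue_outer_nonnull_cube n (x : 'rV[R]_n) r : 0 < r ->
  lebesgue_outer (cube x r) <> 0%E.
Proof.
move=> r0; rewrite lebesgue_outer_cube ?ltW// => -[] /eqP.
by rewrite expf_eq0 mulf_eq0 pnatr_eq0/= (gt_eqF r0) andbF.
Qed.

End rV_measurable.

(** * Covers by small cubes *)

Section cube_covers.
Context {R : realType}.

Lemma esum_finType (I : finType) (J : set I) (a : I -> \bar R) :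
  (forall i, 0 <= a i)%E ->
  (\esum_(i in J) a i = \sum_i (if i \in J then a i else 0))%E.
Proof.
move=> a0; rewrite esum_mkcond.
have -> : [set: I] = [set` index_enum I].
  by apply/seteqP; split => // i _ /=; rewrite mem_index_enum.
rewrite esum_fset; last 2 first.
- exact: finite_finset.
- by move=> i _; case: ifP.
by rewrite -fsbig_seq ?index_enum_uniq.
Qed.

(** Continuity at 0 of a polynomial in [t]: lengthening every side of a box a little costs little
    volume. *)
Lemma prod_add_small n (s : 'I_n -> R) (e : R) : 0 < e ->
  exists2 d : R, 0 < d & forall t : R, 0 < t < d -> \prod_i (s i + t) < \prod_i s i + e.
Proof.
move=> e0; pose p : {poly R} := \prod_i ((s i)%:P + 'X).
have pE t : p.[t] = \prod_i (s i + t).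
  by rewrite /p horner_prod; apply: eq_bigr => i _; rewrite !hornerE.
have /cvgrPdist_lt/(_ _ e0) := @continuous_horner _ p 0.
move=> /nbhs_ballP[d /= d0 dP]; exists d => // t /andP[t0 td].
have := dP t; rewrite /ball/= sub0r normrN gtr0_norm// => /(_ td).
rewrite !pE; under eq_bigr do rewrite addr0.
by rewrite distrC => /(le_lt_trans (ler_norm _)); rewrite ltrBlDl.
Qed.

(** The volume of a cube, unlike that of a box, is a fixed multiple of a power of its diameter, so
    it controls images under Lipschitz maps and Hausdorff gauges. Radii are positive even outside
    [D], which spares side conditions later. *)
Definition small_cubes n (A : set 'rV[R]_n) (delta : R) (c : \bar R) :=
  exists (D : set nat) (x : nat -> 'rV[R]_n) (r : nat -> R),
  [/\ forall k, 0 < r k <= delta, A `<=` \bigcup_(k in D) cube (x k) (r k) &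
    (\esum_(k in D) ((2 * r k) ^+ n)%:E < c)%E].

Lemma small_cubes_countable n (I : countType) (J : set I) (x : I -> 'rV[R]_n)
    (r : I -> R) (A : set 'rV[R]_n) (delta : R) (c : \bar R) : 0 < delta ->
  (forall i, 0 < r i <= delta) -> A `<=` \bigcup_(i in J) cube (x i) (r i) ->
  (\esum_(i in J) ((2 * r i) ^+ n)%:E < c)%E -> small_cubes A delta c.
Proof.
move=> delta0 rdelta AJ Jc.
exists (@pickle I @` J), (fun k => if @unpickle I k is Some i then x i else 0),
  (fun k => if @unpickle I k is Some i then r i else delta); split.
- by move=> k; case: unpickle => [i|]; [exact: rdelta|rewrite delta0 lexx].
- move=> y /AJ[i Ji yi]; exists (pickle i); first by exists i.
  by rewrite pickleK.
- rewrite (reindex_esum J _ (@pickle I)).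
    by under eq_esum do rewrite pickleK.
  by apply: inj_bij => i j _ _ /(pcan_inj pickleK).
Qed.

Lemma small_cubes_box n (a b : 'rV[R]_n) (e delta : R) : 0 < e -> 0 < delta ->
  small_cubes (box a b) delta (box_volume a b + e)%:E.
Proof.
move=> e0 delta0; pose s i := Num.max 0 (b 0 i - a 0 i).
have s0 i : 0 <= s i by rewrite le_max lexx.
have [d d0 dP] := prod_add_small s e0.
pose r := Num.min delta (d / 4).
have r0 : 0 < r by rewrite lt_min delta0 divr_gt0.
have rd : 2 * r < d.
  by have : r <= d / 4 by [rewrite ge_min lexx orbT]; lra.
(* Number of grid cells of step [2 * r] along side [i]; the successor keeps the far face covered
   when the step divides the side. [M] only gives all cell indices a common finite type, and [J]
   selects the true cells. *)
pose N i := (Num.truncn (s i / (2 * r))).+1.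
pose M := \max_i N i.
have NM i : (N i <= M)%N by exact: leq_bigmax.
pose J := [set f : {ffun 'I_n -> 'I_M} | forall i, (f i < N i)%N].
apply: (@small_cubes_countable n {ffun 'I_n -> 'I_M} J
  (fun f => a + \row_i ((f i)%:R * 2 * r + r)) (fun=> r)) => //.
- by move=> _; rewrite r0 ge_min lexx.
- move=> y yab.
  have tN (i : 'I_n) : (Num.truncn ((y 0 i - a 0 i) / (2 * r))%R < N i)%N.
    rewrite ltnS truncn_le_nat; apply: le_lt_trans (truncnS_gt _).
    rewrite ler_pM2r ?invr_gt0 ?mulr_gt0//.
    by rewrite le_max; have := yab i; lra.
  exists [ffun i => Ordinal (leq_trans (tN i) (NM i))].
    by rewrite /J/= => i; rewrite ffunE /=; exact: tN.
  rewrite cubeE ?ltW//=; apply: mx_norm_le => [|j i]; first exact: ltW.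
  rewrite ord1 !mxE ffunE/=; set z := (y 0 i - a 0 i) / (2 * r).
  have yE : y 0 i = a 0 i + z * (2 * r).
    by rewrite /z divfK ?mulf_neq0 ?gt_eqF// addrC subrK.
  have /truncn_itv : 0 <= z.
    by apply: divr_ge0; [rewrite subr_ge0; have /andP[] := yab i|rewrite mulr_ge0// ltW].
  set k := (_%:R : R); rewrite -natr1 -/k => /andP[kz zk].
  rewrite yE ler_norml; apply/andP; split; nra.
rewrite esum_finType; last by move=> f; rewrite lee_fin exprn_ge0// mulr_ge0// ltW.
(* The total volume of the grid factors over the coordinates: side [i] contributes [N i] times
   [2 * r], which exceeds [s i] by at most [2 * r < d]. *)
pose F i (j : 'I_M) := if (j < N i)%N then 2 * r else 0.
have F0 i j : 0 <= F i j by rewrite /F; case: ifP => // _; rewrite mulr_ge0// ltW.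
apply: (@le_lt_trans _ _ (\sum_(f : {ffun 'I_n -> 'I_M}) \prod_i F i (f i))%:E).
  rewrite -sumEFin; apply: lee_sum => f _; case: ifPn => [|_]; last first.
    by rewrite lee_fin; exact: prodr_ge0.
  rewrite inE/= => Jf; rewrite lee_fin.
  rewrite -[X in _ ^+ X]card_ord -prodr_const; apply: ler_prod => i _.
  by rewrite /F Jf lexx mulr_ge0// ltW.
rewrite lte_fin -bigA_distr_bigA/=.
apply: le_lt_trans (dP (2 * r) _); last by rewrite mulr_gt0//=; exact: rd.
apply: ler_prod => i _; rewrite sumr_ge0//=.
rewrite /F -big_mkcond -(big_ord_widen _ (fun=> 2 * r) (NM i)).
rewrite sumr_const card_ord /N mulrSr lerD2r -[leLHS]mulr_natr.
rewrite mulrC -ler_pdivlMr ?mulr_gt0//.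
by rewrite truncn_le divr_ge0// mulr_ge0// ltW.
Qed.

Lemma small_cubes_cover n (A : set 'rV[R]_n) (delta : R) (c : \bar R) : 0 < delta ->
  (lebesgue_outer A < c)%E -> small_cubes A delta c.
Proof.
move=> delta0 Ac; have [D [a [b [AD Dc]]]] := lebesgue_outer_cover Ac.
have [e e0 ec] : exists2 e : R, 0 < e &
    (\esum_(k in D) (box_volume (a k) (b k))%:E + e%:E < c)%E.
  move: Dc; set S := (esum _ _).
  have : (0 <= S)%E by apply: esum_ge0 => k _; exact: box_volumee_ge0.
  case: S => [s| |]; case: c {Ac} => [c| |]//= s0 sc.
  - exists ((c - s) / 2); first by rewrite divr_gt0// subr_gt0.
    by rewrite -EFinD lte_fin; move: sc; rewrite lte_fin; lra.
  - by exists 1 => //; rewrite -EFinD ltry.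
have {ec} : (\esum_(k in D) ((box_volume (a k) (b k))%:E +
    (e / (2 ^ k.+1)%:R)%:E) < c)%E.
  apply: le_lt_trans ec.
  rewrite esumD; last 2 first.
  - by move=> *; exact: box_volumee_ge0.
  - by move=> *; rewrite lee_fin divr_ge0// ltW.
  rewrite leeD2l//; apply: (@le_trans _ _ (\esum_(k in [set: nat]) (e / (2 ^ k.+1)%:R)%:E)).
    rewrite esum_mkcond; apply: le_esum => k _; case: ifP => // _.
    by rewrite lee_fin divr_ge0// ltW.
  rewrite -nneseries_esumT; last by move=> k; rewrite lee_fin divr_ge0// ltW.
  have := @epsilon_trick R (fun=> 0%E) e xpredT (fun=> lexx _) (ltW e0).
  under eq_eseriesr do rewrite add0e.
  by rewrite [X in (_ <= X + _)%E]eseries0// add0e.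
move=> sumc.
have ek0 k : 0 < e / (2 ^ k.+1)%:R by rewrite divr_gt0// ltr0n expn_gt0.
pose P k (w : set nat * (nat -> 'rV[R]_n) * (nat -> R)) :=
  [/\ forall j, 0 < w.2 j <= delta,
    box (a k) (b k) `<=` \bigcup_(j in w.1.1) cube (w.1.2 j) (w.2 j) &
    (\esum_(j in w.1.1) ((2 * w.2 j) ^+ n)%:E <
      (box_volume (a k) (b k) + e / (2 ^ k.+1)%:R)%:E)%E].
have [w Pw] : {w & forall k, P k (w k)}.
  apply: (@choice _ _ P) => k.
  have [Dk [x [r [rd cov sum]]]] := small_cubes_box (a k) (b k) (ek0 k) delta0.
  by exists (Dk, x, r).
apply: (@small_cubes_countable n (nat * nat)%type (D `*`` (fun k => (w k).1.1))
  (fun k => (w k.1).1.2 k.2) (fun k => (w k.1).2 k.2)) => //.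
- by move=> [k j] /=; have [+ _ _] := Pw k; apply.
- move=> y /AD[k Dk yk]; have [_ /(_ _ yk)[j wj yj] _] := Pw k.
  by exists (k, j).
- rewrite -(esum_esum (a := fun k j => ((2 * (w k).2 j) ^+ n)%:E)).
    apply: le_lt_trans sumc; apply: le_esum => k _.
    by have [_ _ /ltW] := Pw k; rewrite EFinD.
  move=> k j _ _; rewrite lee_fin exprn_ge0// mulr_ge0//.
  by have [/(_ j)/andP[/ltW]] := Pw k.
Qed.

End cube_covers.

(** * Null sets under expanding maps, and Fubini along lines and rays *)

Section lipschitz_measure.
Context {R : realType}.
Local Open Scope ereal_scope.

Lemma nneseries_esum_cond (D : set nat) (a : nat -> \bar R) : (forall k, 0 <= a k) ->
  \esum_(k in D) a k = \sum_(k <oo) (if k \in D then a k else 0).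
Proof.
move=> a0; rewrite nneseries_esumT; last by move=> k; case: ifP.
by rewrite esum_mkcond.
Qed.

Lemma ge0_esumZl (D : set nat) (a : nat -> \bar R) (c : R) : (0 <= c)%R ->
  (forall k, 0 <= a k) ->
  \esum_(k in D) (c%:E * a k) = c%:E * \esum_(k in D) a k.
Proof.
move=> c0 a0; rewrite !nneseries_esum_cond//; last first.
  by move=> k; rewrite mule_ge0// lee_fin.
rewrite -nneseriesZl; last by move=> k _; case: ifP.
by apply: eq_eseriesr => k _; case: ifP; rewrite ?mule0.
Qed.

(** The part of [Z] sent into a cube of radius [r] has diameter at most [2 * C * r], so it lies in a
    cube of that radius around one of its own points. This recentring is the reason for [2 * C] in
    place of [C]. *)
Lemma lebesgue_outer_expanding n (Z : set 'rV[R]_n) (f : 'rV[R]_n -> 'rV[R]_n) (C : R) :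
  (0 < C)%R ->
  (forall x y, Z x -> Z y -> (`|x - y| <= C * `|f x - f y|)%R) ->
  lebesgue_outer Z <= ((2 * C) ^+ n)%:E * lebesgue_outer (f @` Z).
Proof.
move=> C0 fC; have C2 : (0 < (2 * C) ^+ n)%R by rewrite exprn_gt0// mulr_gt0.
have [->|foo] := eqVneq (lebesgue_outer (f @` Z)) +oo.
  by rewrite gt0_muley ?leey// lte_fin.
apply/lee_addgt0Pr => e e0.
have fc : lebesgue_outer (f @` Z) <
    lebesgue_outer (f @` Z) + (((2 * C) ^+ n)^-1 * e)%:E.
  rewrite lteDl ?lte_fin ?mulr_gt0 ?invr_gt0//.
  by rewrite ge0_fin_numE ?lebesgue_outer_ge0// ltey.
have [D [x [r [rd fD rc]]]] := small_cubes_cover ltr01 fc.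
have r0 k : (0 <= r k)%R by have /andP[/ltW] := rd k.
pose Zk k := Z `&` [set z | cube (x k) (r k) (f z)].
(* The default 0 occurs only when [Zk k] is empty, and then the cube around it has nothing to
   cover. *)
pose z k := xget 0%R (Zk k).
have ZkP k y : Zk k y -> Zk k (z k) by move=> Zy; exact: (xgetI 0%R Zy).
have cov : Z `<=` \bigcup_(k in D) cube (z k) (C * (2 * r k)).
  move=> y Zy; have [|k Dk yk] := fD (f y); first by exists y.
  exists k => //; rewrite cubeE; last by rewrite !mulr_ge0 ?r0// ltW.
  have [Zz zk] : Zk k (z k) by apply: (ZkP k y); split.
  apply: (le_trans (fC _ _ Zy Zz)); rewrite ler_pM2l//.
  move: yk zk; rewrite !cubeE//= => yk zk.
  rewrite (le_trans (ler_distD (x k) _ _))// (distrC (x k)).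
  by rewrite mulr_natl mulr2n lerD.
have -> : ((2 * C) ^+ n)%:E * lebesgue_outer (f @` Z) + e%:E =
   ((2 * C) ^+ n)%:E * (lebesgue_outer (f @` Z) + (((2 * C) ^+ n)^-1 * e)%:E).
  rewrite muleDr//; last first.
    by rewrite ge0_adde_def// inE ?lebesgue_outer_ge0// lee_fin mulr_ge0 ?invr_ge0 ?ltW.
  by rewrite -[X in _ = _ + X]EFinM mulVKf// gt_eqF.
apply: (@le_trans _ _ (((2 * C) ^+ n)%:E * \esum_(k in D) ((2 * r k) ^+ n)%:E)); last first.
  by rewrite lee_pmul2l// ltW.
rewrite -ge0_esumZl; [|exact: ltW|]; last first.
  by move=> k; rewrite lee_fin exprn_ge0 ?mulr_ge0.
apply: (le_trans (lebesgue_outer_le_esum cov)); apply: le_esum => k _.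
have := @lebesgue_outer_cube R n (z k) (C * (2 * r k))%R.
rewrite lebesgue_outer_box => ->; last by rewrite !mulr_ge0// ltW.
have -> : (2 * (C * (2 * r k)) = 2 * C * (2 * r k))%R by rewrite mulrA.
by rewrite -EFinM -exprMn.
Qed.

Lemma lebesgue_outer_null_expanding n (Z : set 'rV[R]_n)
    (f : 'rV[R]_n -> 'rV[R]_n) (C : R) :
  (forall x y, Z x -> Z y -> (`|x - y| <= C * `|f x - f y|)%R) ->
  lebesgue_outer (f @` Z) = 0 -> lebesgue_outer Z = 0.
Proof.
move=> fC f0; apply/eqP; rewrite eq_le lebesgue_outer_ge0 andbT.
(* [C] may be nonpositive here, while the quantitative bound wants it positive. *)
have C1 : (0 < Num.max C 1)%R by rewrite lt_max ltr01 orbT.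
rewrite (le_trans (@lebesgue_outer_expanding n Z f _ C1 _))//; last first.
  by rewrite f0 mule0.
move=> x y Zx Zy; rewrite (le_trans (fC x y Zx Zy))// ler_wpM2r//.
by rewrite le_max lexx.
Qed.

Lemma lebesgue_outer_null_affine n (Z : set 'rV[R]_n) (s : R) v : s != 0%R ->
  lebesgue_outer [set x | Z (s *: x + v)%R] = 0 -> lebesgue_outer Z = 0.
Proof.
move=> s0 Z0; apply: (@lebesgue_outer_null_expanding _ _
    (fun y => s^-1 *: (y - v))%R `|s|%R).
  move=> x y _ _; rewrite -scalerBr opprB addrA subrK normrZ normfV mulrA.
  by rewrite divff ?normr_eq0// mul1r distrC.
apply: lebesgue_outer_nullS Z0 => _ [y Zy <-] /=.
by rewrite scalerA divff// scale1r subrK.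
Qed.

Lemma lebesgue_outer_open_cover n (A : set 'rV[R]_n) (c : \bar R) :
  lebesgue_outer A < c ->
  exists U : set 'rV[R]_n, [/\ open U, A `<=` U & lebesgue_outer U < c].
Proof.
move=> /(small_cubes_cover ltr01)[D [x [r [rd AD Dc]]]].
have r0 k : (0 < r k)%R by have /andP[] := rd k.
(* Inflating the closed cubes by a factor [l > 1] makes open boxes around them, their radii being
   positive; [l ^+ n] must be close enough to 1 to stay below [c]. *)
have [l l1 lc] : exists2 l : R, (1 < l)%R &
    (l ^+ n)%:E * (\esum_(k in D) ((2 * r k) ^+ n)%:E) < c.
  have : 0 <= \esum_(k in D) ((2 * r k) ^+ n)%:E.
    by apply: esum_ge0 => k _; rewrite lee_fin exprn_ge0// mulr_ge0// ltW.
  move: Dc; case: (esum _ _) => [s sc s0| |]; [|by rewrite ltNge leey|by []].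
  have [e e0 ec] : exists2 e : R, (0 < e)%R & ((1 + e) * s)%:E < c.
    have s1 : (0 < s + 1)%R by rewrite ltr_wpDl.
    case: c sc => [c| |]// sc; last by exists 1%R => //; rewrite ltry.
    (* Division by [s + 1] because the sum [s] may be 0. *)
    exists ((c - s) / (s + 1))%R; first by rewrite divr_gt0// subr_gt0.
    rewrite lte_fin mulrDl mul1r -ltrBrDl mulrAC ltr_pdivrMr//.
    by rewrite ltr_pM2l ?subr_gt0// ltrDl.
  have [d d0 dP] := prod_add_small (fun _ : 'I_n => 1%R) e0.
  exists (1 + d / 2)%R; first by rewrite ltrDl divr_gt0.
  have := dP (d / 2)%R; rewrite !prodr_const !card_ord expr1n => /(_ _)/ltW led.
  apply: le_lt_trans ec; rewrite -EFinM lee_fin ler_wpM2r// led//.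
  by rewrite divr_gt0//= ltr_pdivrMr// mulr2n mulrDr mulr1 ltrDl.
exists (\bigcup_(k in D) obox (x k - const_mx (l * r k))%R (x k + const_mx (l * r k))%R); split.
- by apply: bigcup_open => k _; exact: obox_open.
- move=> y /AD[k Dk yk]; exists k => // i; have := yk i; rewrite !mxE.
  by have := r0 k; nra.
- apply: le_lt_trans lc; rewrite -ge0_esumZl; last 2 first.
    by rewrite exprn_ge0// ltW// (lt_trans _ l1).
    by move=> k; rewrite lee_fin exprn_ge0// mulr_ge0// ltW.
  apply: (@le_trans _ _ (\esum_(k in D)
    (box_volume (x k - const_mx (l * r k))%R (x k + const_mx (l * r k))%R)%:E)).
    apply: lebesgue_outer_le_esum => y [k Dk yk]; exists k => // i.
    by have /andP[/ltW -> /ltW ->] := yk i.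
  apply: le_esum => k _; rewrite -lebesgue_outer_box -/(cube _ _).
  have lr0 : (0 <= l * r k)%R by rewrite mulr_ge0 ?ltW// (lt_trans _ l1).
  rewrite lebesgue_outer_cube//.
  by rewrite -EFinM -exprMn lee_fin mulrCA.
Qed.

Lemma ae_lebesgue_ex (P : R -> Prop) : {ae @lebesgue_measure R, forall s, P s} ->
  exists2 s, s != 0%R & P s.
Proof.
move=> [N [mN N0 PN]]; apply: contrapT => noP.
(* An interval of positive measure that avoids 0, since [s] will serve as a dilation factor. *)
have : lebesgue_measure (`[1%R, 2%R]%classic : set R) <= lebesgue_measure N.
  apply: le_measure; rewrite ?inE//.
  move=> s /=; rewrite in_itv/= => s1; apply: PN => Ps; apply: noP.
  by exists s => //; rewrite gt_eqF//; lra.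
rewrite N0 lebesgue_measure_itv/= lte_fin ltr1n/= -EFinB lee_fin; lra.
Qed.

Lemma measurable_preimage_setT d d' (T : measurableType d) (T' : measurableType d')
  (f : T -> T') (A : set T') : measurable_fun setT f -> measurable A ->
  measurable (f @^-1` A).
Proof. by move=> mf mA; rewrite -[X in measurable X]setTI; exact: mf. Qed.

Lemma ae_null_sections_swap_fun d1 d2 (T1 : measurableType d1)
    (T2 : measurableType d2) (m1 : {sigma_finite_measure set T1 -> \bar R})
    (m2 : {sigma_finite_measure set T2 -> \bar R}) (E : T1 -> T2 -> Prop) :
  measurable [set xy : T1 * T2 | E xy.1 xy.2] ->
  {ae m1, forall x, m2 [set y | E x y] = 0} ->
  {ae m2, forall y, m1 [set x | E x y] = 0}.
Proof.
move=> mE E1.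
have := @ae_null_sections_swap _ _ _ _ _ m1 m2 _ mE.
have xE x : xsection [set xy : T1 * T2 | E xy.1 xy.2] x = [set y | E x y].
  by apply/seteqP; split=> y; rewrite /xsection/= inE.
have yE y : ysection [set xy : T1 * T2 | E xy.1 xy.2] y = [set x | E x y].
  by apply/seteqP; split=> x; rewrite /ysection/= inE.
move=> h; have := h _; move/(_ ltac:(by apply: filterS E1 => x; rewrite xE)).
by apply: filterS => y; rewrite yE.
Qed.

(* Fubini for [Z (x + s *: v)] in [(x, s)] and translation invariance: some translate of
   [Z] is null. *)
Lemma null_along_lines n (Z : set 'rV[R]_n) (v : 'rV[R]_n) : borel Z ->
  (forall x, lebesgue_measure [set s : R | Z (x + s *: v)%R] = 0) ->
  lebesgue_outer Z = 0.
Proof.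
move=> mZ Z0.
have /ae_lebesgue_ex[s _ sZ] : {ae @lebesgue_measure R, forall s,
    @lebesgue_rV R n [set x | Z (x + s *: v)%R] = 0}.
  apply: (@ae_null_sections_swap_fun _ _ (rVborel R n) (measurableTypeR R)
    (@lebesgue_rV R n) (@lebesgue_measure R)
    (fun x s => Z (x + s *: v)%R)); last exact: aeW.
  apply: (@measurable_preimage_setT _ _ _ (rVborel R n)
    (fun xs : rVborel R n * measurableTypeR R => (xs.1 : 'rV[R]_n) + xs.2 *: v)%R Z _ mZ).
  apply: measurable_fun_rV => i; under eq_fun do rewrite !mxE.
  apply: measurable_funD.
    by apply: (measurableT_comp (measurable_rV_entry i)).
  by apply: measurable_funM.
apply: (@lebesgue_outer_null_affine _ _ 1 (s *: v)%R (oner_neq0 _)).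
by under eq_set do rewrite scale1r.
Qed.

(** Fubini for [Z (s *: x)] in [(x, s)]: some nonzero dilate of [Z] is null. It suits sets that are
    understood only along lines through the origin. *)
Lemma null_along_rays n (Z : set 'rV[R]_n) : borel Z ->
  (forall x, lebesgue_measure [set s : R | Z (s *: x)%R] = 0) ->
  lebesgue_outer Z = 0.
Proof.
move=> mZ Z0.
have /ae_lebesgue_ex[s s0 sZ] : {ae @lebesgue_measure R, forall s,
    @lebesgue_rV R n [set x | Z (s *: x)%R] = 0}.
  apply: (@ae_null_sections_swap_fun _ _ (rVborel R n) (measurableTypeR R)
    (@lebesgue_rV R n) (@lebesgue_measure R)
    (fun x s => Z (s *: x)%R)); last exact: aeW.
  apply: (@measurable_preimage_setT _ _ _ (rVborel R n)
    (fun xs : rVborel R n * measurableTypeR R => xs.2 *: (xs.1 : 'rV[R]_n))%R Z _ mZ).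
  apply: measurable_fun_rV => i; under eq_fun do rewrite !mxE.
  apply: measurable_funM => //.
  by apply: (measurableT_comp (measurable_rV_entry i)).
apply: (@lebesgue_outer_null_affine _ _ s 0%R s0).
by under eq_set do rewrite addr0.
Qed.

End lipschitz_measure.

(** * Differentiability of Lipschitz functions *)

Definition differentiable1 {R : realType} (f : R -> R) (x : R) :=
  exists y : R, forall e : R, 0 < e -> exists2 r : R, 0 < r &
    forall s, `|s| < r -> `|f (x + s) - f x - s * y| <= e * `|s|.

Section lipschitz_differentiable1.
Context {R : realType}.

Definition clamp (M x : R) := Num.max (- M) (Num.min x M).

Lemma clamp_id M x : - M <= x <= M -> clamp M x = x.
Proof. by move=> /andP[Mx xM]; rewrite /clamp min_l// max_r. Qed.

Lemma clampB M x y : 0 < M -> x <= y -> 0 <= clamp M y - clamp M x <= y - x.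
Proof.
move=> M0 xy; rewrite /clamp !maxEle !minEle; do ! case: ifPn; rewrite -?ltNge; lra.
Qed.

(* Adding a steep linear function makes a Lipschitz function increasing; its normalized
   clamp is the distribution function of an absolutely continuous probability, whose
   density gives the derivative. *)
Definition tilted_cdf (f : R -> R) (K M x : R) : R :=
  let F x := f (clamp M x) + (K + 1) * clamp M x in
  (F x - F (- M)) / (F M - F (- M)).

Section fixed_function.
Variables (f : R -> R) (K M : R).
Hypotheses (M0 : 0 < M) (fK : forall x y, `|f x - f y| <= K * `|x - y|).

Let F x := f (clamp M x) + (K + 1) * clamp M x.
Let G := tilted_cdf f K M.
Let D := F M - F (- M).

Let K0 : 0 <= K.
Proof. by have := fK 1 0; rewrite subr0 normr1 mulr1; apply: le_trans. Qed.

(** The slope [K + 1], rather than [K], makes [F] grow at least as fast as the clamp, so the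
    normalizing constant [D] is positive. *)
Let FB x y : x <= y ->
  clamp M y - clamp M x <= F y - F x <= (2 * K + 1) * (clamp M y - clamp M x).
Proof.
move=> xy; have /andP[c0 _] := clampB M0 xy; have := fK (clamp M y) (clamp M x).
by rewrite (ger0_norm c0) ler_norml /F; lra.
Qed.

Let D0 : 0 < D.
Proof.
have MM : - M <= M by move: M0; lra.
have := FB MM; rewrite !clamp_id ?lexx ?MM// /D => /andP[+ _].
by move: M0; lra.
Qed.

Let GE x : G x = (F x - F (- M)) / D. Proof. by []. Qed.

Let GB x y : x <= y -> 0 <= G y - G x <= (2 * K + 1) / D * (y - x).
Proof.
move=> xy; rewrite !GE -mulrBl opprB addrA subrK.
have := FB xy; have := clampB M0 xy => /andP[c0 c1] /andP[F0 F1].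
apply/andP; split; first by apply: divr_ge0; [exact: le_trans F0|exact: ltW].
rewrite mulrAC ler_pM2r ?invr_gt0// (le_trans F1)// ler_pM2l//.
by move: K0; lra.
Qed.

Let G_nd : nondecreasing G.
Proof. by move=> x y /GB; rewrite subr_ge0 => /andP[]. Qed.

Let L := (2 * K + 1) / D.
Let L0 : 0 < L. Proof. by rewrite divr_gt0//; move: K0; lra. Qed.

Let G_continuous : continuous G.
Proof.
move=> x; apply/cvgrPdist_le => e e0; near=> y.
have GL u v : `|G u - G v| <= L * `|u - v|.
  wlog uv : u v / v <= u.
    move=> h; have [uv|/ltW vu] := leP v u; first exact: h.
    by rewrite distrC (distrC u); exact: h.
  by have /andP[g0 g1] := GB uv; rewrite !ger0_norm// subr_ge0.
rewrite (le_trans (GL _ _))// -ler_pdivlMl//.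
near: y; apply: cvgr_dist_le; first exact: cvg_id.
by rewrite mulr_gt0// invr_gt0.
Unshelve. all: by end_near. Qed.

Let G_rc : right_continuous (tilted_cdf f K M).
Proof. exact: (right_continuousW G_continuous). Qed.

HB.instance Definition _ := isCumulative.Build R _ R (tilted_cdf f K M) G_nd G_rc.

Let G_Ny : tilted_cdf f K M @ -oo --> (0 : R).
Proof.
apply: cvg_near_cst; exists (- M); split; first exact: num_real.
move=> x xM; rewrite -/(G x) GE /F (_ : clamp M x = clamp M (- M)) ?subrr ?mul0r//.
by rewrite /clamp !maxEle !minEle; do ! case: ifPn; rewrite -?ltNge; move: M0; lra.
Qed.

Let G_y : tilted_cdf f K M @ +oo --> (1 : R).
Proof.
apply: cvg_near_cst; exists M; split; first exact: num_real.
move=> x xM; rewrite -/(G x) GE (_ : F x = F M); first by rewrite divff// gt_eqF.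
rewrite /F (_ : clamp M x = clamp M M)//.
by rewrite /clamp !maxEle !minEle; do ! case: ifPn; rewrite -?ltNge; move: M0; lra.
Qed.

HB.instance Definition _ := isCumulativeBounded.Build R 0 1 (tilted_cdf f K M) G_Ny G_y.

Let Gc : cumulativeBounded (0 : R) (1 : R) := tilted_cdf f K M.
Let nu := lebesgue_stieltjes_measure Gc.

Local Open Scope ereal_scope.

Let wlength_lipschitz (X : set (ocitv_type R)) : measurable X ->
  wlength (tilted_cdf f K M) X <= L%:E * wlength idfun X.
Proof.
move=> /ocitvP[->|[[a b] /= ab ->]]; first by rewrite !wlength0 mule0.
rewrite !wlength_itv_bnd; [|exact: ltW|exact: ltW].
rewrite -EFinM lee_fin.
by have /andP[_] := GB (ltW ab).
Qed.

Let nuE a b : (a <= b)%R -> nu `]a, b]%classic = (G b - G a)%:E.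
Proof.
move=> ab; rewrite /nu /lebesgue_stieltjes_measure /measure_extension.
by rewrite measurable_mu_extE/= ?wlength_itv_bnd//; exact: is_ocitv.
Qed.

(** Both measures are infima over covers by half-open intervals, and [wlength_lipschitz] compares
    the two costs of one cover. *)
Let nu_dominated : nu `<< @lebesgue_measure R.
Proof.
apply/null_content_dominatesP => A mA A0.
apply/eqP; rewrite eq_le measure_ge0 andbT.
apply/lee_addgt0Pr => e e0; rewrite add0e.
have : @lebesgue_measure R A < (e / L)%:E by rewrite A0 lte_fin divr_gt0.
move=> /ereal_inf_lt[_ [B [mB AB] <-]] Be.
apply: (@le_trans _ _ (\sum_(k <oo) wlength (tilted_cdf f K M) (B k))).
  by apply: ereal_inf_lbound; exists B.
apply: (@le_trans _ _ (\sum_(k <oo) (L%:E * wlength idfun (B k)))).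
  by apply: lee_nneseries => k *; [exact: (@wlength_ge0 R Gc)|exact: wlength_lipschitz].
rewrite nneseriesZl; last by move=> k _; exact: wlength_ge0.
have -> : e = (L * (e / L))%R by rewrite mulrCA divff ?mulr1// gt_eqF.
have L0e : 0 <= L%:E by rewrite lee_fin ltW.
by rewrite EFinM; exact: (lee_wpmul2l L0e (ltW Be)).
Qed.

Lemma lipschitz_differentiable1_ball :
  {ae @lebesgue_measure R, forall x, (`|x| < M)%R -> differentiable1 f x}.
Proof.
have [g [g0 gfin intg nug]] := radon_nikodym_sigma_finite nu_dominated.
pose h := fine \o g.
have hE : EFin \o h = g by apply/funext => x; rewrite /= fineK.
have inth A : measurable A -> (@lebesgue_measure R).-integrable A (EFin \o h).
  by move=> mA; rewrite hE; exact: (integrableS measurableT).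
have loch : locally_integrable [set: R] h.
  by apply: open_integrable_locally; [exact: openT|exact: inth].
(* The open left end gives integrals over the half-open intervals from [- M] to [y], whose [nu]
   measure is [G y] because [G] vanishes at [- M]. *)
have := @FTC1 R h (BRight (- M)%R) (fun y => inth _ (measurable_itv _)) loch.
apply: filterS; first exact: (ae_filter_ringOfSetsType (@lebesgue_measure R)).
move=> x xF /ltr_normlP[xM1 xM2].
have MxO : (BRight (- M)%R < BRight x)%O by rewrite ltBSide/= ltrNl.
have [+ _] := xF MxO.
set H := (X in derivable X) => dH.
have HE y : (- M <= y)%R -> H y = G y.
  move=> My; rewrite /H /Rintegral.
  under eq_integral do rewrite -[(h _)%:E]/((EFin \o h) _) hE.
  rewrite -nug; last exact: measurable_itv.
  by rewrite -[LHS]/(fine (nu _)) nuE// (GE (- M)) subrr mul0r subr0.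
move: dH => /cvg_ex[/= l /cvgrPdist_le dH].
(* Undoing the tilt: inside the clamp the derivative of [G] is that of [f] plus [K + 1], divided by
   [D]. *)
exists (D * l - (K + 1))%R => e e0.
have eD : (0 < e / D)%R by rewrite divr_gt0.
have /nbhs_ballP[r /= r0 rP] := dH _ eD.
exists (Num.min r (M - `|x|))%R.
  by rewrite lt_min r0 subr_gt0 ltr_norml; lra.
move=> s; rewrite lt_min => /andP[sr sM].
have [->|s0] := eqVneq s 0%R; first by rewrite addr0 mul0r subrr subr0 !normr0 mulr0.
have := rP s; rewrite /ball/= sub0r normrN => /(_ sr s0).
have xs : (`|x + s| < M)%R by rewrite (le_lt_trans (ler_normD _ _))//; lra.
move: xs => /ltr_normlP[xs1 xs2].
rewrite (_ : s *: 1 + x = x + s)%R; last by rewrite [(s *: 1)%R]mulr1 addrC.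
rewrite !HE; [|by move: xM1; lra|by move: xs1; lra].
have GF : (G (x + s) - G x = (f (x + s) + (K + 1) * (x + s) - (f x + (K + 1) * x)) / D)%R.
  rewrite !GE -mulrBl opprB addrA subrK /F !clamp_id//.
    by apply/andP; split; move: xM1 xM2; lra.
  by apply/andP; split; move: xs1 xs2; lra.
rewrite GF => h1.
have -> : (f (x + s) - f x - s * (D * l - (K + 1)) =
  - (D * s * (l - s^-1 * ((f (x + s) + (K + 1) * (x + s) - (f x + (K + 1) * x)) / D))))%R.
  by field; rewrite s0 gt_eqF.
rewrite normrN !normrM (gtr0_norm D0).
have -> : (e * `|s| = D * `|s| * (e / D))%R.
  by field; rewrite gt_eqF.
by apply: ler_wpM2l => //; rewrite mulr_ge0// ltW.
Qed.

End fixed_function.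

Lemma lipschitz_differentiable1 (f : R -> R) (K : R) :
  (forall x y, `|f x - f y| <= K * `|x - y|) ->
  {ae @lebesgue_measure R, forall x, differentiable1 f x}.
Proof.
move=> fK; pose P k := [set x : R | `|x| < k.+1%:R -> differentiable1 f x].
suff : (@lebesgue_measure R).-negligible (\bigcup_k ~` P k).
  apply: negligibleS => x /= nx; exists (Num.truncn `|x|) => //= Px.
  by apply: nx; apply: Px; exact: truncnS_gt.
by apply: negligible_bigcup => k; exact: (lipschitz_differentiable1_ball (ltr0Sn _ k) fK).
Qed.

End lipschitz_differentiable1.

(** * Nonporosity at almost every point of a Borel set *)

Section nonporous.
Context {R : realType}.

(* A gap of radius [delta |h|] at distance [|h|] would lower the density of [F] at [x]
   by a fixed amount. *)
Lemma density_nonporous (F : set R) (delta : R) : 0 < delta ->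
  measurable (F : set (measurableTypeR R)) ->
  {ae @lebesgue_measure R, forall x, F x -> exists2 r : R, 0 < r &
    forall h, `|h| < r -> exists2 z, F z & `|x + h - z| <= delta * `|h|}.
Proof.
(* With [d <= 1] the gap, a ball of radius [d * |h|] around [x + h], lies in the ball of radius
   [2 * |h|] around [x]. *)
move=> delta0 mF; pose d := Num.min delta 1.
have d0 : 0 < d by rewrite lt_min delta0 ltr01.
have d1 : d <= 1 by rewrite ge_min lexx orbT.
have := lebesgue_density mF.
apply: filterS; first exact: (ae_filter_ringOfSetsType (@lebesgue_measure R)).
move=> x /= dx Fx; move: dx; rewrite indicE mem_set//= => dx.
have U : nbhs (1%:E : \bar R) [set y : \bar R | ((1 - d / 4)%:E < y)%E].
  apply: open_nbhs_nbhs; split; first exact: open_ereal_gt_ereal.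
  by rewrite /= lte_fin ltrBlDr ltrDl divr_gt0.
have /nbhs_ballP[r /= r0 rP] := dx _ U.
exists (r / 2) => [|h hr]; first by rewrite divr_gt0.
have [->|h0] := eqVneq h 0.
  by exists x => //; rewrite addr0 subrr !normr0 mulr0.
have {}h0 : 0 < `|h| by rewrite normr_gt0.
apply: contrapT => noz; have := rP (2 * `|h|).
rewrite /ball/= sub0r normrN normrM normr_id gtr0_norm// mulr_gt0//.
have hr2 : 2 * `|h| < r by rewrite mulrC -ltr_pdivlMr.
move=> /(_ hr2 isT); apply/negP; rewrite -leNgt.
have rho0 : 0 <= 2 * `|h| by rewrite mulr_ge0.
set B := ball x (2 * `|h|).
have mB : measurable (B : set (measurableTypeR R)) by exact: measurable_ball.
pose B' := ball (x + h) (d * `|h|).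
have mB' : measurable (B' : set (measurableTypeR R)) by exact: measurable_ball.
have B'B : B' `<=` B.
  move=> z; rewrite /B /B' /ball/= => zh.
  rewrite (le_lt_trans (ler_distD (x + h) _ _))//.
  rewrite opprD addrA subrr sub0r normrN.
  by move: zh; have : d * `|h| <= `|h| by [rewrite ler_piMl]; lra.
have FB : F `&` B `<=` B `\` B'.
  move=> z [Fz Bz]; split => //; rewrite /B' /ball/= => zh.
  apply: noz; exists z => //; rewrite (le_trans (ltW zh))//.
  by rewrite ler_wpM2r// ge_min lexx.
have muB : lebesgue_measure B = (4 * `|h|)%:E.
  by rewrite /B lebesgue_measure_ball//; congr EFin; rewrite -mulr_natr; lra.
have muB' : lebesgue_measure B' = (2 * d * `|h|)%:E.
  rewrite /B' lebesgue_measure_ball ?mulr_ge0// ?ltW//; congr EFin.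
  by rewrite -mulr_natr; lra.
have leFB : (lebesgue_measure (F `&` B) <= (4 * `|h| - 2 * d * `|h|)%:E)%E.
  apply: (@le_trans _ _ (lebesgue_measure (B `\` B'))).
    by apply: le_measure; rewrite ?inE; [exact: measurableI|exact: measurableD|].
  rewrite measureD//; last by rewrite [X in (X < _)%E]muB ltry.
  by rewrite [X in (X - _)%E]muB setIidr// [X in (_ - X)%E]muB' -EFinB.
rewrite muB inver mulf_eq0 pnatr_eq0/= (gt_eqF h0).
apply: (@le_trans _ _ ((4 * `|h| - 2 * d * `|h|)%:E * ((4 * `|h|)^-1)%:E)%E).
  by apply: lee_wpmul2r => //; rewrite lee_fin invr_ge0 mulr_ge0.
rewrite -EFinM lee_fin ler_pdivrMr ?mulr_gt0//.
by nra.
Qed.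

End nonporous.

Lemma countable_bigcup_measurable d (T : measurableType d) (I : countType)
    (P : set I) (F : I -> set T) :
  (forall i, P i -> measurable (F i)) -> measurable (\bigcup_(i in P) F i).
Proof.
move=> mF; rewrite bigcup_cond_setT.
apply: countable_bigcupT_measurable; first exact: countableP.
by move=> i; case: asboolP => // Pi; exact: mF.
Qed.

Lemma countable_bigcap_measurable d (T : measurableType d) (I : countType)
    (P : set I) (F : I -> set T) :
  (forall i, P i -> measurable (F i)) -> measurable (\bigcap_(i in P) F i).
Proof.
move=> mF; rewrite -[X in measurable X]setCK setC_bigcap; apply: measurableC.
by apply: countable_bigcup_measurable => i Pi; apply: measurableC; exact: mF.
Qed.

Section nonporous_rV.
Context {R : realType} {n : nat}.
Implicit Types (F : set 'rV[R]_n) (x h z : 'rV[R]_n).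

Local Notation e_ i := (delta_mx 0 i : 'rV[R]_n).

Definition take_row (j : nat) h : 'rV[R]_n :=
  \row_i (if (i < j)%N then h 0 i else 0).

Lemma take_row0 h : take_row 0 h = 0.
Proof. by apply/rowP => i; rewrite !mxE ltn0. Qed.

Lemma take_row_full h : take_row n h = h.
Proof. by apply/rowP => i; rewrite !mxE ltn_ord. Qed.

Lemma take_rowS (i : 'I_n) h : take_row i.+1 h = take_row i h + h 0 i *: e_ i.
Proof.
apply/rowP => k; rewrite !mxE eqxx/= ltnS leq_eqVlt.
have [->|ki] := eqVneq k i; first by rewrite eqxx ltnn mulr1 add0r.
by rewrite -val_eqE in ki; rewrite (negbTE ki)/= mulr0 addr0.
Qed.

Lemma norm_take_row_le j h : `|take_row j h| <= `|h|.
Proof.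
apply: mx_norm_le => // k i; rewrite mxE; case: ifP => _; last by rewrite normr0.
exact: ler_entry_norm.
Qed.

Lemma norm_scale_delta_le (s : R) (i : 'I_n) : `|s *: e_ i| <= `|s|.
Proof. by rewrite normrZ ler_piMr// norm_delta_mx_le. Qed.

Definition nonporous_at (j : nat) F (delta : R) x :=
  exists2 r : R, 0 < r & forall h, `|h| < r ->
    exists2 z, F z & `|x + take_row j h - z| <= delta * `|h|.

Definition axis_near (i : 'I_n) F (delta : R) (rho : rat) :=
  [set x | ratr rho != 0 :> R ->
    exists2 z, F z & `|x + ratr rho *: e_ i - z| < delta * `|ratr rho|].

Definition axis_thick (i : 'I_n) F (delta : R) (q : nat) :=
  F `&` \bigcap_(rho in [set rho : rat | `|ratr rho : R| < q.+1%:R^-1])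
    axis_near i F delta rho.

Lemma axis_near_open i F delta rho : open (axis_near i F delta rho).
Proof.
rewrite /axis_near; have [->|r0] := eqVneq (ratr rho : R) 0.
  by rewrite (_ : [set _ | _] = setT); [exact: openT|apply/seteqP; split].
rewrite (_ : [set _ | _] = \bigcup_(z in F)
    ball (z - ratr rho *: e_ i) (delta * `|ratr rho|)).
  by apply: bigcup_open => z _; exact: ball_open.
apply/seteqP; split => x /=.
  move=> /(_ isT)[z Fz xz]; exists z => //.
  by rewrite rV_ballE -normrN opprB opprB addrA.
move=> [z Fz]; rewrite rV_ballE => xz _; exists z => //.
by move: xz; rewrite -normrN opprB opprB addrA.
Qed.

Lemma axis_thick_borel i F delta q : borel F -> borel (axis_thick i F delta q).
Proof.
move=> mF; apply: (@measurableI _ (rVborel R n)) => //.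
apply: (@countable_bigcap_measurable _ (rVborel R n) rat) => rho _.
by apply: open_measurable_rV; exact: axis_near_open.
Qed.

Lemma not_axis_thick_null i F delta : 0 < delta -> borel F ->
  lebesgue_outer (F `\` \bigcup_q axis_thick i F delta q) = 0%E.
Proof.
move=> delta0 mF; set N := _ `\` _.
have mN : borel N.
  apply: (@measurableD _ (rVborel R n)) => //.
  by apply: (@bigcupT_measurable _ (rVborel R n)) => q; exact: axis_thick_borel.
apply: (null_along_lines (v := e_ i) mN) => x.
pose Fx := [set s : R | F (x + s *: e_ i)].
have mline : measurable_fun [set: measurableTypeR R]
    (fun s : measurableTypeR R => x + (s : R) *: e_ i : rVborel R n).
  apply: measurable_fun_rV => k; under eq_fun do rewrite !mxE.
  apply: measurable_funD; first exact: measurable_cst.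
  by apply: measurable_funM => //; exact: measurable_cst.
have mNx : measurable ([set s : R | N (x + s *: e_ i)] : set (measurableTypeR R)).
  exact: (measurable_preimage_setT mline mN).
have mFx : measurable (Fx : set (measurableTypeR R)).
  exact: (measurable_preimage_setT mline mF).
have delta20 : 0 < delta / 2 by rewrite divr_gt0.
have [B [mB B0 NB]] := density_nonporous delta20 mFx.
apply/eqP; rewrite eq_le measure_ge0 andbT -B0.
apply: le_measure; rewrite ?inE// => s /= [Fs nthick].
apply: NB => /= thick; apply: nthick.
have [r r0 rP] := thick Fs.
have /ltr_add_invr[q] := r0; rewrite add0r => qr.
exists q => //; split => // rho /= rhoq rho0.
have [z Fz zrho] := rP (ratr rho) (lt_trans rhoq qr).
exists (x + z *: e_ i) => //.
have -> : x + s *: e_ i + ratr rho *: e_ i - (x + z *: e_ i) =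
    (s + ratr rho - z) *: e_ i.
  by rewrite -[x + _ + _]addrA opprD addrACA subrr add0r scalerBl scalerDl.
rewrite (le_lt_trans (norm_scale_delta_le _ _))// (le_lt_trans zrho)//.
by rewrite ltr_pM2r ?normr_gt0// ltr_pdivrMr// ltr_pMr// ltr1n.
Qed.

Lemma rat_near_neq0 (s e : R) : 0 < e ->
  exists2 rho : rat, ratr rho != 0 :> R & `|s - ratr rho| < e.
Proof.
move=> e0; have [s0|s0] := leP 0 s.
  have /rat_in_itvoo[rho] : s < s + e by rewrite ltrDl.
  rewrite in_itv/= => h; exists rho; first by rewrite gt_eqF//; lra.
  by rewrite ltr_norml; lra.
have /rat_in_itvoo[rho] : s - e < s by rewrite ltrBlDr ltrDl.
rewrite in_itv/= => h; exists rho; first by rewrite lt_eqF//; lra.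
by rewrite ltr_norml; lra.
Qed.

(* Coordinates are handled one at a time: [F] is first replaced by its subset of points
   from which all small steps along the last axis end close to [F]. *)
Lemma ae_nonporous_take j F delta : (j <= n)%N -> 0 < delta -> borel F ->
  lebesgue_outer [set x | F x /\ ~ nonporous_at j F delta x] = 0%E.
Proof.
elim: j F delta => [|j IH] F delta jn delta0 mF.
  rewrite (_ : [set _ | _] = set0) ?lebesgue_outer0//.
  apply/seteqP; split => // x [Fx]; apply; exists 1 => // h _.
  by exists x => //; rewrite take_row0 addr0 subrr normr0 mulr_ge0// ltW.
pose i := Ordinal jn.
pose eta := delta / 4.
have eta0 : 0 < eta by rewrite divr_gt0.
apply: (@lebesgue_outer_nullS _ _ _
  ((F `\` \bigcup_q axis_thick i F eta q) `|`
   \bigcup_q [set x | axis_thick i F eta q x /\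
                      ~ nonporous_at j (axis_thick i F eta q) eta x])); last first.
  apply: lebesgue_outer_nullU; first exact: not_axis_thick_null.
  apply: lebesgue_outer_null_bigcup => q; apply: IH => //; first exact: ltnW.
  exact: axis_thick_borel.
move=> x [Fx npF]; have [[q _ xq]|nthick] := pselect ((\bigcup_q axis_thick i F eta q) x).
  2: by left.
right; exists q => //; split => // -[r r0 rP]; apply: npF.
exists (Num.min r (q.+1%:R^-1 / 2)); first by rewrite lt_min r0 divr_gt0.
move=> h; rewrite lt_min => /andP[hr hq].
have [->|h0] := eqVneq h 0.
  exists x => //; rewrite normr0 mulr0.
  rewrite (_ : take_row _ _ = 0) ?addr0 ?subrr ?normr0//.
  by apply/rowP => k; rewrite !mxE if_same.
have {}h0 : 0 < `|h| by rewrite normr_gt0.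
have [z [Fz thz] xz] := rP h hr.
have e0 : 0 < Num.min eta 1 * `|h| by rewrite mulr_gt0// lt_min eta0 ltr01.
have [rho rho0 rhoh] := rat_near_neq0 (h 0 i) e0.
have hi := ler_entry_norm h 0 i.
have eh1 : Num.min eta 1 * `|h| <= `|h| by rewrite ler_piMl// ge_min lexx orbT.
have eh2 : Num.min eta 1 * `|h| <= eta * `|h|.
  by rewrite ler_wpM2r// ge_min lexx.
have rho2 : `|ratr rho| <= 2 * `|h|.
  have := ler_distD (h 0 i) (ratr rho) 0; rewrite !subr0 (distrC (ratr rho)).
  by lra.
have [|z' Fz' zz'] := thz rho _ rho0.
  by rewrite /= (le_lt_trans rho2)// mulrC -ltr_pdivlMr.
exists z' => //; rewrite (take_rowS i).
have -> : x + (take_row i h + h 0 i *: e_ i) - z' =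
  (x + take_row j h - z) + ((h 0 i - ratr rho) *: e_ i + (z + ratr rho *: e_ i - z')).
  rewrite scalerBl -[take_row i h]/(take_row j h).
  by apply/rowP => k; move: (take_row j h) => w; rewrite !mxE; ring.
rewrite (le_trans (ler_normD _ _))// (le_trans (lerD (lexx _) (ler_normD _ _)))//.
have := norm_scale_delta_le (h 0 i - ratr rho) i.
have : eta * `|ratr rho| <= eta * (2 * `|h|) by rewrite ler_pM2l.
have -> : delta = 4 * eta by rewrite /eta; field.
by move: xz zz' rhoh eh2; nra.
Qed.

Lemma ae_nonporous F delta : 0 < delta -> borel F ->
  lebesgue_outer [set x | F x /\ ~ nonporous_at n F delta x] = 0%E.
Proof. by move=> ? ?; exact: ae_nonporous_take. Qed.

End nonporous_rV.

Lemma lipschitz_rV_continuous {R : realType} n (g : 'rV[R]_n -> R) (L : R) :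
  (forall x y, `|g x - g y| <= L * `|x - y|) -> continuous g.
Proof.
move=> gL x A /nbhs_ballP[e /= e0 eA].
have L1 : 0 < `|L| + 1 by rewrite ltr_wpDl.
apply/nbhs_ballP; exists (e / (`|L| + 1)); first by rewrite /= divr_gt0.
move=> y; rewrite rV_ballE => xy; apply: eA; rewrite /ball/=.
rewrite (le_lt_trans (gL _ _))// (@le_lt_trans _ _ ((`|L| + 1) * `|x - y|))//.
  by rewrite ler_wpM2r// (le_trans (ler_norm L))// lerDl.
by rewrite -ltr_pdivlMl// mulrC.
Qed.

Section rademacher.
Context {R : realType} {n : nat}.
Variables (f : 'rV[R]_n -> R) (K : R).
Hypothesis fK : forall x y, `|f x - f y| <= K * `|x - y|.
Implicit Types (x h z : 'rV[R]_n).

Local Notation e_ i := (delta_mx 0 i : 'rV[R]_n).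

Definition axis_secant (i : 'I_n) (e y : R) (p : nat) := [set x : 'rV[R]_n |
  forall s : R, `|s| < p.+1%:R^-1 -> `|f (x + s *: e_ i) - f x - s * y| <= e * `|s|].

Lemma axis_secant_closed i e y p : closed (axis_secant i e y p).
Proof.
rewrite (_ : axis_secant i e y p = \bigcap_(s in [set s : R | `|s| < p.+1%:R^-1])
  (fun x => `|f (x + s *: e_ i) - f x - s * y|) @^-1` [set u | u <= e * `|s|]).
  apply: closed_bigI => s _; apply: preimage_closed; last exact: closed_le.
  move=> x0 _; apply: (@lipschitz_rV_continuous _ _ _ (2 * K)) => x z.
  rewrite (le_trans (ler_dist_dist _ _))//.
  have -> : f (x + s *: e_ i) - f x - s * y - (f (z + s *: e_ i) - f z - s * y) =
    (f (x + s *: e_ i) - f (z + s *: e_ i)) - (f x - f z) by ring.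
  rewrite (le_trans (ler_normB _ _))//.
  have := fK (x + s *: e_ i) (z + s *: e_ i); have := fK x z.
  by rewrite opprD addrACA subrr addr0; lra.
by apply/seteqP; split=> x.
Qed.

Lemma axis_secant_borel i e y p : borel (axis_secant i e y p).
Proof. by apply: closed_measurable_rV; exact: axis_secant_closed. Qed.

Definition axis_differentiable (i : 'I_n) := \bigcap_(k : nat)
  \bigcup_(yp : rat * nat) axis_secant i k.+1%:R^-1 (ratr yp.1) yp.2.

Lemma not_axis_differentiable_null i :
  lebesgue_outer (~` axis_differentiable i) = 0%E.
Proof.
set N := ~` _.
have mN : borel N.
  apply: (@measurableC _ (rVborel R n)).
  apply: (@bigcapT_measurable _ (rVborel R n)) => k.
  apply: (@countable_bigcup_measurable _ (rVborel R n) (rat * nat)%type) => yp _.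
  exact: axis_secant_borel.
apply: (null_along_lines (v := e_ i) mN) => x.
have mline : measurable_fun [set: measurableTypeR R]
    (fun s : measurableTypeR R => x + (s : R) *: e_ i : rVborel R n).
  apply: measurable_fun_rV => k; under eq_fun do rewrite !mxE.
  apply: measurable_funD; first exact: measurable_cst.
  by apply: measurable_funM => //; exact: measurable_cst.
have mNx : measurable ([set s : R | N (x + s *: e_ i)] : set (measurableTypeR R)).
  exact: (measurable_preimage_setT mline mN).
pose g (s : R) := f (x + s *: e_ i).
have K1 : K <= `|K| by exact: ler_norm.
have gK s t : `|g s - g t| <= `|K| * `|s - t|.
  rewrite (le_trans (fK _ _))// opprD addrACA subrr add0r -scalerBl.
  rewrite (le_trans (ler_wpM2r _ K1))//.
  by rewrite ler_wpM2l// norm_scale_delta_le.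
have [B [mB B0 NB]] := lipschitz_differentiable1 gK.
apply/eqP; rewrite eq_le measure_ge0 andbT -B0.
apply: le_measure; rewrite ?inE// => s /= Ns.
apply: NB => /= -[y gy]; apply: Ns => k _.
have k0 : 0 < k.+1%:R^-1 / 2 :> R by rewrite divr_gt0.
have [r r0 rP] := gy _ k0.
have /ltr_add_invr[p] := r0; rewrite add0r => pr.
have [rho _ rhoy] := rat_near_neq0 y k0.
exists (rho, p) => // t /= tp.
have := rP t (lt_trans tp pr); rewrite /g scalerDl addrA => ft.
have -> : f (x + s *: e_ i + t *: e_ i) - f (x + s *: e_ i) - t * ratr rho =
   (f (x + s *: e_ i + t *: e_ i) - f (x + s *: e_ i) - t * y) + t * (y - ratr rho).
  by ring.
rewrite (le_trans (ler_normD _ _))// normrM.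
rewrite [leRHS]mulrC (splitr k.+1%:R^-1) mulrDr; apply: lerD; first by rewrite [leRHS]mulrC.
by rewrite ler_wpM2l// ltW.
Qed.

Definition rV_differentiable_at x := exists y : 'I_n -> R, forall e : R, 0 < e ->
  exists2 r : R, 0 < r & forall h, `|h| < r ->
    `|f (x + h) - f x - \sum_i h 0 i * y i| <= e * `|h|.

Let fK' x z : `|f x - f z| <= `|K| * `|x - z|.
Proof. by rewrite (le_trans (fK x z))// ler_wpM2r// ler_norm. Qed.

Lemma nonporous_secant (e delta : R) (y : 'I_n -> R) (p : 'I_n -> nat) x :
  0 <= e -> 0 <= delta -> `|K| * delta <= e ->
  nonporous_at n (\bigcap_(i in [set: 'I_n]) axis_secant i e (y i) (p i)) delta x ->
  exists2 r : R, 0 < r & forall h, `|h| < r ->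
    `|f (x + h) - f x - \sum_i h 0 i * y i| <= n%:R * (3 * e) * `|h|.
Proof.
move=> e0 delta0 Kde [r r0 rP].
pose P := \max_i p i.
exists (Num.min r P.+1%:R^-1); first by rewrite lt_min r0 invr_gt0 ltr0n.
move=> h; rewrite lt_min => /andP[hr hP].
have -> : f (x + h) - f x - \sum_i h 0 i * y i =
    \sum_(i < n) (f (x + take_row i.+1 h) - f (x + take_row i h) - h 0 i * y i).
  rewrite sumrB; congr (_ - _).
  rewrite -(big_mkord xpredT (fun i => f (x + take_row i.+1 h) - f (x + take_row i h))).
  by rewrite telescope_sumr// take_row_full take_row0 addr0.
rewrite (le_trans (ler_norm_sum _ _ _))//.
rewrite (@le_trans _ _ (\sum_(i < n) 3 * e * `|h|))//; last first.
  by rewrite sumr_const card_ord -[leLHS]mulr_natl mulrA.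
apply: ler_sum => i _.
have hi := norm_take_row_le i h.
have [z zF xz] := rP (take_row i h) (le_lt_trans hi hr).
have {}xz : `|x + take_row i h - z| <= delta * `|h|.
  move: xz; rewrite take_row_full => /le_trans; apply.
  by rewrite ler_wpM2l.
have hi0 := ler_entry_norm h 0 i.
have hpi : `|h 0 i| < (p i).+1%:R^-1.
  rewrite (le_lt_trans hi0)// (lt_le_trans hP)// lef_pV2 ?posrE ?ltr0n//.
  by rewrite ler_nat ltnS; exact: leq_bigmax.
have := zF i Logic.I (h 0 i) hpi; set s := h 0 i => zs.
rewrite take_rowS -/s addrA; set u := x + take_row i h.
have fu : `|f u - f z| <= `|K| * (delta * `|h|).
  by rewrite (le_trans (fK' _ _))// ler_wpM2l.
have fus : `|f (u + s *: e_ i) - f (z + s *: e_ i)| <= `|K| * (delta * `|h|).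
  rewrite (le_trans (fK' _ _))// opprD addrACA subrr addr0.
  by rewrite ler_wpM2l.
have Kd : `|K| * (delta * `|h|) <= e * `|h| by rewrite mulrA ler_wpM2r.
have es : e * `|s| <= e * `|h| by rewrite ler_wpM2l.
have -> : f (u + s *: e_ i) - f u - s * y i =
  (f (u + s *: e_ i) - f (z + s *: e_ i)) - (f u - f z) +
  (f (z + s *: e_ i) - f z - s * y i) by ring.
rewrite (le_trans (ler_normD _ _))// (le_trans (lerD (ler_normB _ _) (lexx _)))//.
by move: fu fus Kd es zs; lra.
Qed.

Lemma ae_secant (e : R) : 0 < e ->
  lebesgue_outer [set x | ~ exists y : 'I_n -> R, exists2 r : R, 0 < r &
    forall h, `|h| < r ->
      `|f (x + h) - f x - \sum_i h 0 i * y i| <= n%:R * (3 * e) * `|h|] = 0%E.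
Proof.
move=> e0.
have /ltr_add_invr[k] := e0; rewrite add0r => ke.
pose ek : R := k.+1%:R^-1.
have ek0 : 0 < ek by rewrite invr_gt0.
pose delta := ek / (`|K| + 1).
have K1 : 0 < `|K| + 1 by rewrite ltr_wpDl.
have delta0 : 0 < delta by rewrite divr_gt0.
pose F (yp : {ffun 'I_n -> rat * nat}) :=
  \bigcap_(i in [set: 'I_n]) axis_secant i ek (ratr (yp i).1) (yp i).2.
have mF yp : borel (F yp).
  apply: (@countable_bigcap_measurable _ (rVborel R n)) => i _.
  exact: axis_secant_borel.
apply: (@lebesgue_outer_nullS _ _ _ ((\bigcup_i ~` axis_differentiable i) `|`
   \bigcup_yp [set x | F yp x /\ ~ nonporous_at n (F yp) delta x])); last first.
  apply: lebesgue_outer_nullU.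
    by apply: lebesgue_outer_null_countable => i; exact: not_axis_differentiable_null.
  by apply: lebesgue_outer_null_countable => yp; exact: ae_nonporous.
move=> x /= noy; apply: contrapT => /not_orP[dx npx].
have {}dx i : axis_differentiable i x.
  by apply: contrapT => ndx; apply: dx; exists i.
have [yp ypx] : {yp : 'I_n -> rat * nat &
    forall i, axis_secant i ek (ratr (yp i).1) (yp i).2 x}.
  apply: (@choice _ _ (fun i yp => axis_secant i ek (ratr yp.1) yp.2 x)) => i.
  by have [yp _ ?] := dx i k Logic.I; exists yp.
have Fx : F (finfun yp) x by move=> i _; rewrite ffunE.
have np : nonporous_at n (F (finfun yp)) delta x.
  by apply: contrapT => np; apply: npx; exists (finfun yp).
apply: noy; exists (fun i => ratr (finfun yp i).1).
have Kd : `|K| * delta <= ek.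
  by rewrite /delta mulrCA ler_piMr// ?(ltW ek0)// ler_pdivrMr// mul1r lerDl.
have [r r0 rP] := nonporous_secant (ltW ek0) (ltW delta0) Kd np.
exists r => // h /rP /le_trans; apply.
by rewrite ler_wpM2r// ler_wpM2l// ler_wpM2l// ltW.
Qed.

Lemma ae_rV_differentiable :
  lebesgue_outer [set x | ~ rV_differentiable_at x] = 0%E.
Proof.
pose E k : R := n%:R * (3 * k.+1%:R^-1).
have E0 k : 0 <= E k by rewrite !mulr_ge0.
apply: (@lebesgue_outer_nullS _ _ _ (\bigcup_k [set x | ~ exists y : 'I_n -> R,
   exists2 r : R, 0 < r & forall h, `|h| < r ->
      `|f (x + h) - f x - \sum_i h 0 i * y i| <= E k * `|h|])); last first.
  by apply: lebesgue_outer_null_bigcup => k; exact: ae_secant.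
move=> x /= nd; apply: contrapT => npx; apply: nd.
have xP k : exists yr : ('I_n -> R) * R, 0 < yr.2 /\ forall h, `|h| < yr.2 ->
      `|f (x + h) - f x - \sum_i h 0 i * yr.1 i| <= E k * `|h|.
  apply: contrapT => nP; apply: npx; exists k => // -[y [r r0 rP]].
  by apply: nP; exists (y, r).
have [Yr YrP] := choice xP.
pose Y k := (Yr k).1.
have sumE (s : R) i (y : 'I_n -> R) : \sum_j (s *: e_ i) 0 j * y j = s * y i.
  rewrite (bigD1 i)//= big1 ?addr0 => [|j ji]; first by rewrite !mxE !eqxx mulr1.
  by rewrite !mxE (negbTE ji) andbF mulr0 mul0r.
have Ykl k l i : `|Y k i - Y l i| <= E k + E l.
  have [[rk0 rkP] [rl0 rlP]] := (YrP k, YrP l).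
  pose s := Num.min (Yr k).2 (Yr l).2 / 2.
  have s0 : 0 < s by rewrite divr_gt0// lt_min rk0.
  have hs := norm_scale_delta_le s i; rewrite (gtr0_norm s0) in hs.
  have sk : `|s *: e_ i| < (Yr k).2.
    rewrite (le_lt_trans hs)// ltr_pdivrMr// (@le_lt_trans _ _ (Yr k).2)//.
      by rewrite ge_min lexx.
    by rewrite ltr_pMr// ltr1n.
  have sl : `|s *: e_ i| < (Yr l).2.
    rewrite (le_lt_trans hs)// ltr_pdivrMr// (@le_lt_trans _ _ (Yr l).2)//.
      by rewrite ge_min lexx orbT.
    by rewrite ltr_pMr// ltr1n.
  have := rkP _ sk; have := rlP _ sl; rewrite !sumE -/(Y k) -/(Y l) => hl hk.
  rewrite -(ler_pM2l s0) -{1}(gtr0_norm s0) -normrM.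
  have -> : s * (Y k i - Y l i) = (f (x + s *: e_ i) - f x - s * Y l i) -
    (f (x + s *: e_ i) - f x - s * Y k i) by ring.
  rewrite (le_trans (ler_normB _ _))// mulrDr addrC.
  have := ler_wpM2l (E0 k) hs; have := ler_wpM2l (E0 l) hs.
  by rewrite [s * E k]mulrC [s * E l]mulrC; lra.
pose y i := sup [set Y k i - E k | k in [set: nat]].
have Yy k i : `|Y k i - y i| <= E k.
  have ub l : ubound [set Y k i - E k | k in [set: nat]] (Y l i + E l).
    move=> _ [j _ <-]; have := Ykl j l i; rewrite ler_norml; lra.
  have ne : [set Y k i - E k | k in [set: nat]] !=set0 by exists (Y 0%N i - E 0%N), 0%N.
  rewrite ler_distlC; apply/andP; split.
    by apply: ub_le_sup; [exists (Y 0%N i + E 0%N)|exists k].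
  exact: ge_sup.
exists y => e e0.
pose c : R := (n%:R + 1) * n%:R * 3 + 1.
have c0 : 0 < c by rewrite ltr_wpDl// !mulr_ge0// addr_ge0.
have /ltr_add_invr[k] : 0 < e / c by rewrite divr_gt0.
rewrite add0r ltr_pdivlMr// => ke.
have [rk0 rkP] := YrP k.
exists (Yr k).2 => // h hr; have := rkP h hr; rewrite -/(Y k) => hk.
have -> : f (x + h) - f x - \sum_i h 0 i * y i =
   (f (x + h) - f x - \sum_i h 0 i * Y k i) + \sum_i h 0 i * (Y k i - y i).
  by under [X in _ = _ + X]eq_bigr do rewrite mulrBr; rewrite sumrB; ring.
rewrite (le_trans (ler_normD _ _))//.
have hsum : `|\sum_i h 0 i * (Y k i - y i)| <= n%:R * (`|h| * E k).
  rewrite (le_trans (ler_norm_sum _ _ _))//.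
  rewrite (@le_trans _ _ (\sum_(i < n) `|h| * E k))//.
    by apply: ler_sum => i _; rewrite normrM ler_pM// ler_entry_norm.
  by rewrite sumr_const card_ord -[leLHS]mulr_natl.
rewrite (le_trans (lerD hk hsum))//.
have -> : E k * `|h| + n%:R * (`|h| * E k) = (n%:R + 1) * E k * `|h| by ring.
rewrite ler_wpM2r// ltW// (le_lt_trans _ ke)// /c /E.
set a : R := n%:R; set b : R := _^-1.
have b0 : 0 <= b by rewrite /b invr_ge0.
lra.
Qed.

End rademacher.

(** * Lipschitz fields of planes *)

Lemma poly_roots_seq (F : idomainType) (p : {poly F}) : p != 0 ->
  exists s : seq F, forall x, root p x -> x \in s.
Proof.
have [k] := ubnP (size p); elim: k p => // k IH p; rewrite ltnS => pk p0.
have [[a ap]|nor] := pselect (exists a, root p a); last first.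
  by exists [::] => x xp; exfalso; apply: nor; exists x.
have [q pq] := factor_theorem _ _ ap.
have q0 : q != 0 by apply: contraNneq p0 => q0; rewrite pq q0 mul0r.
have [|//|s sP] := IH q.
  apply: leq_trans pk; rewrite pq size_Mmonic ?monicXsubC// size_XsubC addn2.
  by rewrite ltnS.
exists (a :: s) => x; rewrite pq rootM root_XsubC inE => /orP[/sP ->|->//].
by rewrite orbT.
Qed.

Lemma finite_det_pencil0 (F : idomainType) n (M : 'M[F]_n) :
  exists s : seq F, forall x, \det (1%:M + x *: M) = 0 -> x \in s.
Proof.
pose P : 'M[{poly F}]_n := 1%:M + 'X *: map_mx polyC M.
have PE x : (\det P).[x] = \det (1%:M + x *: M).
  rewrite -horner_evalE -det_map_mx; congr (\det _).
  by apply/matrixP => i j; rewrite !mxE/= /horner_eval !hornerE -polyC_natr hornerC.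
have P0 : \det P != 0.
  apply/eqP => P0; have := PE 0; rewrite P0 horner0 scale0r addr0 det1.
  by move/eqP; rewrite eq_sym oner_eq0.
have [s sP] := poly_roots_seq P0.
by exists s => x detx; apply: sP; rewrite /root PE detx.
Qed.

Section moving_planes.
Context {R : realType} {n m : nat}.
Variables (w : 'rV[R]_n -> 'M[R]_(m, n)) (K : R).
Hypothesis wK : forall x y, `|w x - w y| <= K * `|x - y|.
Implicit Types (x : 'rV[R]_n) (t : 'rV[R]_m).

Definition plane_pt x t : 'rV[R]_n := x + t *m w x.

Let K0 x y : K * `|x - y| <= `|K| * `|x - y|.
Proof. by rewrite ler_wpM2r// ler_norm. Qed.

Lemma entry_lipschitz j k x y : `|w x j k - w y j k| <= K * `|x - y|.
Proof.
by have := ler_entry_norm (w x - w y) j k; rewrite !mxE => /le_trans; apply.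
Qed.

Lemma plane_pt_lipschitz t x y :
  `|plane_pt x t - plane_pt y t - (x - y)| <= m%:R * `|t| * (`|K| * `|x - y|).
Proof.
have -> : plane_pt x t - plane_pt y t - (x - y) = t *m (w x - w y).
  rewrite /plane_pt mulmxBr; move: (t *m w x) (t *m w y) => a b.
  by apply/rowP => i; rewrite !mxE; ring.
rewrite (le_trans (norm_mulmx_le _ _))// ler_wpM2l ?mulr_ge0//.
by rewrite (le_trans (wK _ _)).
Qed.

Lemma measurable_plane_pt :
  measurable_fun [set: rVborel R m * rVborel R n]
    (fun tx => plane_pt tx.2 tx.1 : rVborel R n).
Proof.
apply: measurable_fun_rV => i; under eq_fun do rewrite !mxE.
apply: measurable_funD.
  exact: (measurableT_comp (measurable_rV_entry i)).
apply: measurable_sum => j; apply: measurable_funM.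
  exact: (measurableT_comp (measurable_rV_entry j)).
apply: (@measurableT_comp _ _ _ _ (rVborel R n) _ (fun x : 'rV[R]_n => w x j i)) => //.
by apply: continuous_measurable_rV; exact: (lipschitz_rV_continuous (entry_lipschitz j i)).
Qed.

Definition expanding_at (j : nat) t x := forall y, `|y - x| < j.+1%:R^-1 ->
  `|y - x| <= j.+1%:R * `|plane_pt y t - plane_pt x t|.

(* By continuity only rational [y] matter. *)
Lemma expanding_at_measurable j :
  measurable [set tx : rVborel R m * rVborel R n | expanding_at j tx.1 tx.2].
Proof.
pose c : R := j.+1%:R.
pose bad (q : 'rV[rat]_n) (tx : rVborel R m * rVborel R n) : Prop :=
  let y := map_mx ratr q : 'rV[R]_n in
  (`|y - tx.2| < c^-1) /\
  (0 < `|y - tx.2| - c * `|plane_pt y tx.1 - plane_pt tx.2 tx.1|).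
rewrite (_ : [set tx | _] = ~` \bigcup_q [set tx | bad q tx]).
  apply: measurableC; apply: countable_bigcup_measurable => q _.
  set y := map_mx ratr q : 'rV[R]_n.
  have mdist : measurable_fun [set: rVborel R m * rVborel R n] (fun tx => `|y - tx.2|).
    apply: (@measurableT_comp _ _ _ _ (rVborel R n) _ (fun x : 'rV[R]_n => `|y - x|)) => //.
    apply: continuous_measurable_rV; apply: (@lipschitz_rV_continuous _ _ _ 1) => x x'.
    rewrite (le_trans (ler_dist_dist _ _))//.
    by rewrite opprB [y - x + _]addrC addrA subrK distrC mul1r.
  have mdist' : measurable_fun [set: rVborel R m * rVborel R n]
      (fun tx => `|plane_pt y tx.1 - plane_pt tx.2 tx.1|).
    apply: (@measurableT_comp _ _ _ _ (rVborel R n) _ (fun x : 'rV[R]_n => `|x|) _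
      (fun tx : rVborel R m * rVborel R n => plane_pt y tx.1 - plane_pt tx.2 tx.1 : rVborel R n)).
      exact: measurable_fun_norm_rV.
    apply: measurable_fun_rV => i; under eq_fun do rewrite !mxE.
    apply: measurable_funB.
      apply: measurable_funD; first exact: measurable_cst.
      apply: measurable_sum => l; apply: measurable_funM; last exact: measurable_cst.
      exact: (measurableT_comp (measurable_rV_entry l)).
    have := measurableT_comp (measurable_rV_entry i) measurable_plane_pt.
    by apply: eq_measurable_fun => tx _; rewrite /= /plane_pt !mxE.
  rewrite (_ : [set tx | _] = [set tx | `|y - tx.2| < c^-1] `&`
    [set tx | 0 < `|y - tx.2| - c * `|plane_pt y tx.1 - plane_pt tx.2 tx.1|])//.
  apply: measurableI.
    rewrite (_ : [set tx | _] =
      (fun tx : rVborel R m * rVborel R n => `|y - tx.2|) @^-1` `]-oo, c^-1[%classic).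
      by apply: measurable_preimage_setT => //; exact: measurable_itv.
    by apply/seteqP; split=> tx; rewrite /= in_itv.
  rewrite (_ : [set tx | _] = (fun tx : rVborel R m * rVborel R n =>
    `|y - tx.2| - c * `|plane_pt y tx.1 - plane_pt tx.2 tx.1|) @^-1` `]0, +oo[%classic).
    apply: measurable_preimage_setT; last exact: measurable_itv.
    apply: measurable_funB => //; apply: measurable_funM => //.
  by apply/seteqP; split=> tx; rewrite /= in_itv/= andbT.
apply/seteqP; split=> [[t x] /= ex [q _ [/= qx]]|[t x] /= nbad y yx].
  by apply/negP; rewrite -leNgt subr_le0; exact: ex.
rewrite leNgt; apply/negP => ylt; apply: nbad.
pose g (z : 'rV[R]_n) := `|z - x| - c * `|plane_pt z t - plane_pt x t|.
have gc : continuous g.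
  apply: (@lipschitz_rV_continuous _ _ _ (1 + c * (1 + m%:R * `|t| * `|K|))) => z z'.
  have -> : g z - g z' = (`|z - x| - `|z' - x|) -
     c * (`|plane_pt z t - plane_pt x t| - `|plane_pt z' t - plane_pt x t|).
    by rewrite /g; ring.
  have h1 : `|(`|z - x| - `|z' - x|)| <= `|z - z'|.
    by rewrite (le_trans (ler_dist_dist _ _))// opprB addrA subrK.
  have h2 : `|(`|plane_pt z t - plane_pt x t| - `|plane_pt z' t - plane_pt x t|)| <=
      `|z - z'| + m%:R * `|t| * (`|K| * `|z - z'|).
    rewrite (le_trans (ler_dist_dist _ _))// opprB addrA subrK.
    have := plane_pt_lipschitz t z z'.
    have := ler_normD (z - z') (plane_pt z t - plane_pt z' t - (z - z')).
    by rewrite [z - z' + _]addrC subrK; lra.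
  rewrite (le_trans (ler_normB _ _))// normrM (ger0_norm (ler0n _ _)).
  have c0 : 0 <= c by rewrite ler0n.
  by have := ler_wpM2l c0 h2; lra.
have oU : open (ball x c^-1 `&` [set z | 0 < g z]).
  apply: openI; first exact: ball_open.
  by apply: (@open_comp _ _ g [set r | 0 < r]); [move=> z _; exact: gc|exact: open_gt].
have Uy : (ball x c^-1 `&` [set z | 0 < g z]) y.
  by split; [rewrite rV_ballE distrC|rewrite /= subr_gt0].
have [q qy qU] := open_ratbox oU Uy.
have := qU (map_mx ratr (2^-1 *: (q.1 + q.2))).
case.
  move=> i; have := qy i; rewrite !mxE !rmorphM/= rmorphD/= fmorphV/= ratr_nat; lra.
rewrite rV_ballE distrC => qx qg.
by exists (2^-1 *: (q.1 + q.2)).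
Qed.

Lemma plane_sections_expanding_null (A : set 'rV[R]_n) j : borel A -> lebesgue_outer A = 0%E ->
  {ae @lebesgue_rV R n, forall x,
    @lebesgue_rV R m [set t | A (plane_pt x t) /\ expanding_at j t x] = 0%E}.
Proof.
move=> mA A0.
apply: (@ae_null_sections_swap_fun _ _ _ (rVborel R m) (rVborel R n)
  (@lebesgue_rV R m) (@lebesgue_rV R n) (fun t x => A (plane_pt x t) /\ expanding_at j t x)).
  apply: measurableI; last exact: expanding_at_measurable.
  exact: (measurable_preimage_setT measurable_plane_pt mA).
apply: aeW => t.
apply: (@lebesgue_outer_nullS _ _ _ (\bigcup_(q : 'rV[rat]_n)
  [set x | [/\ A (plane_pt x t), expanding_at j t x &
    `|x - map_mx ratr q| < j.+1%:R^-1 / 2]])).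
  move=> x [Ax ex].
  have oU : open (ball x (j.+1%:R^-1 / 2)) by exact: ball_open.
  have Ux : ball x (j.+1%:R^-1 / 2) x by apply: ballxx; rewrite divr_gt0.
  have [q qx qU] := open_ratbox oU Ux.
  exists (2^-1 *: (q.1 + q.2)) => //; split => //.
  have := qU (map_mx ratr (2^-1 *: (q.1 + q.2))); rewrite rV_ballE; apply.
  move=> i; have := qx i; rewrite !mxE !rmorphM/= rmorphD/= fmorphV/= ratr_nat; lra.
apply: lebesgue_outer_null_countable => q.
apply: (@lebesgue_outer_null_expanding _ _ _ (plane_pt^~ t) j.+1%:R); last first.
  by apply: lebesgue_outer_nullS A0 => _ [x [Ax _ _] <-].
move=> x y [_ _ xq] [_ ey yq]; apply: ey.
rewrite (le_lt_trans (ler_distD (map_mx ratr q) _ _))// (splitr j.+1%:R^-1).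
by rewrite ltrD// distrC.
Qed.

End moving_planes.

Section differential.
Context {R : realType}.

Lemma common_radius (T : finType) (P : T -> R -> Prop) :
  (forall i r s, 0 < s -> s <= r -> P i r -> P i s) ->
  (forall i, exists2 r, 0 < r & P i r) ->
  exists2 r, 0 < r & forall i, P i r.
Proof.
move=> Ple Pex; have /choice[r rP] i : exists r, 0 < r /\ P i r.
  by have [r r0 Pr] := Pex i; exists r.
have m0 : 0 < \big[Order.min/1]_i r i.
  by apply/bigmin_gtP; split => // i _; exact: (rP i).1.
exists (\big[Order.min/1]_i r i) => // i.
by apply: (Ple _ (r i)) => //; [exact: bigmin_le|exact: (rP i).2].
Qed.

Lemma invertible_differential_expanding n (g : 'rV[R]_n -> 'rV[R]_n) x (B : 'M[R]_n) :
  B \in unitmx ->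
  (forall e, 0 < e -> exists2 r, 0 < r & forall h, `|h| < r ->
    `|g (x + h) - g x - h *m B| <= e * `|h|) ->
  exists j : nat, forall y, `|y - x| < j.+1%:R^-1 ->
    `|y - x| <= j.+1%:R * `|g y - g x|.
Proof.
move=> Bu gB; pose b : R := n%:R * `|invmx B| + 1.
have b0 : 0 < b by rewrite ltr_wpDl// mulr_ge0.
have [|r r0 gr] := gB (2 * b)^-1; first by rewrite invr_gt0 mulr_gt0.
pose j := Num.bound (2 * b + r^-1).
have jb : 2 * b + r^-1 < j.+1%:R.
  rewrite (lt_le_trans (archi_boundP _)) ?ler_nat//.
  by rewrite addr_ge0// ?invr_ge0 ?mulr_ge0 ?ltW.
have ri0 : 0 < r^-1 by rewrite invr_gt0.
exists j => y yx; have yr : `|y - x| < r.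
  rewrite (lt_trans yx)// -[ltRHS]invrK ltf_pV2 ?posrE//.
  by move: jb b0; lra.
have := gr _ yr; rewrite (addrC x) subrK; set h := y - x => gh.
have hb : `|h| <= b * `|h *m B|.
  rewrite -[X in `|X| <= _](mulmxK Bu) (le_trans (norm_mulmx_le _ _))//.
  by rewrite mulrAC ler_wpM2r// lerDl.
have hB : `|h *m B| <= `|g y - g x| + (2 * b)^-1 * `|h|.
  have -> : h *m B = (g y - g x) - (g y - g x - h *m B) by rewrite subKr.
  by rewrite (le_trans (ler_normB _ _))// lerD2l.
have h2 : `|h| <= b * `|g y - g x| + `|h| / 2.
  rewrite (le_trans hb)// (le_trans (ler_wpM2l (ltW b0) hB))// mulrDr lerD2l.
  by rewrite mulrA invfM mulrCA mulfV ?gt_eqF// mulr1 mulrC.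
have : 2 * b * `|g y - g x| <= j.+1%:R * `|g y - g x|.
  by rewrite ler_wpM2r//; move: jb ri0; lra.
by move: h2; lra.
Qed.

End differential.

Section moving_planes_null.
Context {R : realType} {n m : nat}.
Variables (w : 'rV[R]_n -> 'M[R]_(m, n)) (K : R).
Hypothesis wK : forall x y, `|w x - w y| <= K * `|x - y|.

Lemma plane_pt_differential x (y : 'I_m -> 'I_n -> 'I_n -> R) t :
  (forall j k e, 0 < e -> exists2 r, 0 < r & forall h, `|h| < r ->
     `|w (x + h) j k - w x j k - \sum_i h 0 i * y j k i| <= e * `|h|) ->
  forall e, 0 < e -> exists2 r, 0 < r & forall h, `|h| < r ->
    `|plane_pt w (x + h) t - plane_pt w x t -
      h *m (1%:M + \matrix_(i, k) \sum_j t 0 j * y j k i)| <= e * `|h|.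
Proof.
move=> wy e e0; pose c : R := m%:R * `|t| + 1.
have c0 : 0 < c by rewrite ltr_wpDl// mulr_ge0.
have [||r r0 rP] := @common_radius R ('I_m * 'I_n)%type
  (fun jk r => forall h, `|h| < r ->
  `|w (x + h) jk.1 jk.2 - w x jk.1 jk.2 - \sum_i h 0 i * y jk.1 jk.2 i| <=
    e / c * `|h|).
- by move=> jk r s s0 sr rP h /lt_le_trans hs; exact/rP/hs.
- by move=> jk; have [|r r0 rP] := wy jk.1 jk.2 (e / c); [rewrite divr_gt0|exists r].
exists r => // h hr; apply: mx_norm_le => [|i0 k]; first by rewrite mulr_ge0// ltW.
have -> : (plane_pt w (x + h) t - plane_pt w x t -
    h *m (1%:M + \matrix_(i, k) \sum_j t 0 j * y j k i)) i0 k =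
    \sum_j t 0 j * (w (x + h) j k - w x j k - \sum_i h 0 i * y j k i).
  rewrite (ord1 i0) mulmxDr mulmx1 !mxE.
  under [in RHS]eq_bigr do rewrite !mulrBr.
  rewrite !big_split/= !sumrN.
  under [X in _ - (h 0 k + X)]eq_bigr do rewrite mxE mulr_sumr.
  rewrite exchange_big/=.
  under [X in _ = _ - X]eq_bigr do rewrite mulr_sumr.
  rewrite (_ : \sum_j \sum_i h 0 i * (t 0 j * y j k i) =
               \sum_j \sum_i t 0 j * (h 0 i * y j k i)); last first.
    by apply: eq_bigr => j _; apply: eq_bigr => i _; rewrite mulrCA.
  ring.
rewrite (le_trans (ler_norm_sum _ _ _))//.
rewrite (le_trans (y := \sum_(j < m) `|t| * (e / c * `|h|)))//.
  apply: ler_sum => j _; rewrite normrM ler_pM// ?ler_entry_norm//.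
  exact: (rP (j, k)).
rewrite sumr_const card_ord -[leLHS]mulr_natl !mulrA ler_wpM2r//.
rewrite ler_pdivrMr// mulrC; apply: ler_wpM2l; first exact: ltW.
by rewrite lerDl.
Qed.

Lemma det_pencil_null (M : 'rV[R]_m -> 'M[R]_n) :
  (forall i k, continuous (fun t => M t i k)) ->
  (forall s t, M (s *: t) = s *: M t) ->
  lebesgue_outer [set t | \det (1%:M + M t) = 0] = 0%E.
Proof.
move=> Mc MZ; apply: null_along_rays.
  rewrite (_ : [set t | _] = (fun t : rVborel R m => \det (1%:M + M t)) @^-1` [set 0])//.
  apply: (@measurable_preimage_setT _ _ (rVborel R m) (measurableTypeR R)
    (fun t => \det (1%:M + M t)));
    last exact: measurable_set1.
  rewrite /determinant; apply: measurable_sum => s; apply: measurable_funM => //.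
  apply: measurable_prod => i _; under eq_fun do rewrite !mxE.
  by apply: measurable_funD => //; exact: continuous_measurable_rV.
move=> t; have [s sP] := finite_det_pencil0 (M t).
apply: countable_lebesgue_measure0; apply: (@sub_countable _ _ _ [set` s]).
  by apply: subset_card_le => x /=; rewrite MZ; exact: sP.
exact/finite_set_countable/finite_seq.
Qed.

Lemma ae_plane_sections_null (A : set 'rV[R]_n) :
  borel A -> lebesgue_outer A = 0%E ->
  lebesgue_outer [set x | lebesgue_outer [set t | A (plane_pt w x t)] <> 0%E] = 0%E.
Proof.
move=> mA A0.
apply: (@lebesgue_outer_nullS _ _ _
  ((\bigcup_j [set x |
      lebesgue_outer [set t | A (plane_pt w x t) /\ expanding_at w j t x] <> 0%E]) `|`
   \bigcup_(jk : 'I_m * 'I_n)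
     [set x | ~ rV_differentiable_at (fun x => w x jk.1 jk.2) x])); last first.
  apply: lebesgue_outer_nullU; last first.
    apply: lebesgue_outer_null_countable => jk.
    exact: (ae_rV_differentiable (entry_lipschitz wK jk.1 jk.2)).
  apply: lebesgue_outer_null_bigcup => j; apply/negligible_rVP.
  exact: (plane_sections_expanding_null wK j mA A0).
move=> x /= xA; apply: contrapT => nx; apply: xA.
have /choice[y yP] (jk : 'I_m * 'I_n) : rV_differentiable_at (fun x => w x jk.1 jk.2) x.
  by apply: contrapT => nd; apply: nx; right; exists jk.
pose M (t : 'rV[R]_m) : 'M[R]_n := \matrix_(i, k) \sum_j t 0 j * y (j, k) i.
apply: (@lebesgue_outer_nullS _ _ _
  ((\bigcup_j [set t | A (plane_pt w x t) /\ expanding_at w j t x]) `|`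
   [set t | \det (1%:M + M t) = 0])); last first.
  apply: lebesgue_outer_nullU.
    apply: lebesgue_outer_null_bigcup => j.
    by apply: contrapT => nd; apply: nx; left; exists j.
  apply: det_pencil_null => [i k|s t].
    have -> : (fun t => M t i k) = (fun t => \sum_j t 0 j * y (j, k) i).
      by apply/funext => t; rewrite mxE.
    apply: (@lipschitz_rV_continuous _ _ _ (\sum_j `|y (j, k) i|)) => t t'.
    rewrite -sumrB (le_trans (ler_norm_sum _ _ _))// mulr_suml ler_sum// => j _.
    rewrite -mulrBl normrM mulrC ler_wpM2l//.
    by have := ler_entry_norm (t - t') 0 j; rewrite !mxE.
  apply/matrixP => i k; rewrite !mxE mulr_sumr.
  by apply: eq_bigr => j _; rewrite mxE mulrA.
move=> t At; have [|det0] := eqVneq (\det (1%:M + M t)) 0; first by right.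
left; have [||j ej] := @invertible_differential_expanding _ _ (plane_pt w ^~ t) x (1%:M + M t).
- by rewrite unitmxE unitfE.
- by apply: (plane_pt_differential (y := fun j k i => y (j, k) i)) => j k; exact: (yP (j, k)).
by exists j.
Qed.

End moving_planes_null.

Section moving_planes_converse.
Context {R : realType} {n m : nat}.
Variables (w : 'rV[R]_n -> 'M[R]_(m, n)) (K : R).
Hypothesis wK : forall x y, `|w x - w y| <= K * `|x - y|.

Lemma open_excess (A : set 'rV[R]_n) (d : R) : borel A ->
  (lebesgue_outer A < +oo)%E -> 0 < d ->
  exists U, [/\ open U, A `<=` U & (lebesgue_outer (U `\` A) < d%:E)%E].
Proof.
move=> mA Afin d0.
have Af : lebesgue_outer A \is a fin_num by rewrite ge0_fin_numE// lebesgue_outer_ge0.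
have [|U [oU AU Ud]] := @lebesgue_outer_open_cover R n A (lebesgue_outer A + d%:E)%E.
  by rewrite lteDl// lte_fin.
exists U; split => //; move: Ud.
by rewrite (borel_caratheodory mA U) setIC (setIidl AU) lteD2lE.
Qed.

Lemma interior_radius_borel (U : set 'rV[R]_n) r :
  measurable ([set x | ball x r `<=` U] : set (rVborel R n)).
Proof.
rewrite (_ : [set x | _] = ~` \bigcup_(z in ~` U) ball z r).
  apply: measurableC; apply: open_measurable_rV; apply: bigcup_open => z _.
  exact: ball_open.
apply/seteqP; split=> [x /= xU [z nUz /= zx]|x /= nx z xz].
  by apply: nUz; apply: xU; exact: ball_sym.
by apply: contrapT => nUz; apply: nx; exists z => //; exact: ball_sym.
Qed.

Lemma plane_pt_expanding t x y : m%:R * `|t| * `|K| <= 2^-1 ->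
  `|x - y| <= 2 * `|plane_pt w x t - plane_pt w y t|.
Proof.
move=> tK; have h := plane_pt_lipschitz wK t x y.
have : `|x - y| <= `|plane_pt w x t - plane_pt w y t| +
   `|plane_pt w x t - plane_pt w y t - (x - y)|.
  rewrite -[X in `|X| <= _](subKr (plane_pt w x t - plane_pt w y t)).
  exact: ler_normB.
have := ler_wpM2r (normr_ge0 (x - y)) tK.
by move: h; rewrite !mulrA; lra.
Qed.

Lemma plane_sections_null_bounded (A : set 'rV[R]_n) M :
  borel A -> (forall x, A x -> `|x| <= M) ->
  lebesgue_outer [set x | A x /\ lebesgue_outer [set t | A (plane_pt w x t)] <> 0%E] = 0%E ->
  lebesgue_outer A = 0%E.
Proof.
move=> mA AM A0; apply: contrapT => Anz.
have Afin : (lebesgue_outer A < +oo)%E.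
  apply: (@le_lt_trans _ _ (lebesgue_outer (cube 0 `|M|))).
    apply: le_lebesgue_outer => x /AM xM; rewrite cubeE//= subr0.
    by rewrite (le_trans xM)// ler_norm.
  by rewrite lebesgue_outer_cube// ltry.
have Af : lebesgue_outer A \is a fin_num by rewrite ge0_fin_numE// lebesgue_outer_ge0.
pose a := fine (lebesgue_outer A).
have aE : lebesgue_outer A = a%:E by rewrite fineK.
have a0 : 0 < a.
  by rewrite -lte_fin -aE lt_def lebesgue_outer_ge0 andbT; exact/eqP.
pose k : R := (2 * 2) ^+ n; have k0 : 0 < k by rewrite exprn_gt0.
have [|U [oU AU Ua]] := open_excess mA Afin (d := a / (2 * k)).
  by rewrite divr_gt0// mulr_gt0.
pose Aj (j : nat) : set (rVborel R n) := A `&` [set x | ball x j.+1%:R^-1 `<=` U].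
have mAj j : measurable (Aj j).
  by apply: measurableI; [exact: mA|exact: interior_radius_borel].
have AjU : \bigcup_j Aj j = A.
  apply/seteqP; split=> [x [j _ []]//|x Ax].
  have /nbhs_ballP[e /= e0 eU] : nbhs x U by apply: open_nbhs_nbhs; split => //; exact: AU.
  exists (Num.bound e^-1) => //; split => // y xy; apply: eU.
  apply: le_ball xy; rewrite -[leRHS]invrK lef_pV2 ?posrE ?invr_gt0//.
  by rewrite (le_trans (ltW (archi_boundP _))) ?ler_nat// invr_ge0 ltW.
have [j Aja] : exists j, (((a / 2)%:E : \bar R) < lebesgue_outer (Aj j))%E.
  apply: contrapT => /forallNP Ajle.
  have : (@lebesgue_rV R n \o Aj) x @[x --> \oo] --> @lebesgue_rV R n (\bigcup_j Aj j).
    apply: nondecreasing_cvg_mu => //; first by rewrite AjU.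
    move=> i j ij; apply/subsetPset => x [Ax xU]; split => // y xy; apply: xU.
    by apply: le_ball xy; rewrite lef_pV2 ?posrE// ler_nat.
  rewrite AjU => /cvge_to_le => /(_ (a / 2)%:E) h.
  have : ((@lebesgue_rV R n A : \bar R) <= (a / 2)%:E)%E.
    by apply: h; apply: nearW => i; rewrite leNgt; apply/negP; exact: Ajle.
  by rewrite /lebesgue_rV aE lee_fin; move: a0; lra.
pose B := m%:R * (`|w 0| + `|K| * `|M|) + m%:R * `|K|.
have B0 : 0 <= B by rewrite addr_ge0// ?mulr_ge0// addr_ge0// mulr_ge0.
pose r : R := (2 * j.+1%:R * (B + 1))^-1.
have r0 : 0 < r by rewrite invr_gt0 !mulr_gt0// ltr_wpDl.
have rB : B * r < 2^-1 * j.+1%:R^-1.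
  rewrite /r ltr_pdivrMr; last by rewrite !mulr_gt0// ltr_wpDl.
  rewrite (_ : _ * (_ * (B + 1)) = B + 1) ?ltrDl//.
  have c0 : j.+1%:R != 0 :> R by rewrite pnatr_eq0.
  by field.
pose E (x : rVborel R n) (t : rVborel R m) := A x /\ A (plane_pt w x t).
have mE : measurable [set xt : rVborel R n * rVborel R m | E xt.1 xt.2].
  apply: measurableI.
    exact: (measurable_preimage_setT (@measurable_fst _ _ (rVborel R n) (rVborel R m)) mA).
  have := measurableT_comp (measurable_plane_pt wK)
    (@measurable_swap _ _ (rVborel R n) (rVborel R m)).
  by move=> /measurable_preimage_setT; exact.
have Eae : {ae @lebesgue_rV R n, forall x, @lebesgue_rV R m [set t | E x t] = 0%E}.
  apply/negligible_rVP; apply: lebesgue_outer_nullS A0 => x /= nE.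
  have [Ax|nAx] := pselect (A x).
    split => // h; apply: nE; by apply: lebesgue_outer_nullS h => t [].
  by exfalso; apply: nE; rewrite (_ : [set t | _] = set0) ?measure0// -subset0 => t [/nAx].
have /negligible_rVP/= tE := ae_null_sections_swap_fun mE Eae.
apply: (@lebesgue_outer_nonnull_cube R m 0 r r0).
apply: lebesgue_outer_nullS tE => t; rewrite cubeE ?(ltW r0)//= subr0 => tr /= Et.
have tK : m%:R * `|t| * `|K| <= 2^-1.
  rewrite mulrAC; apply: (@le_trans _ _ (B * r)).
    by apply: ler_pM => //; rewrite ?mulr_ge0// /B lerDr mulr_ge0// addr_ge0// mulr_ge0.
  by rewrite (le_trans (ltW rB))// ler_piMr// invf_le1// ler1n.
have tU x : Aj j x -> U (plane_pt w x t).
  move=> [Ax]; apply; rewrite rV_ballE /plane_pt opprD addrA subrr add0r normrN.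
  rewrite (le_lt_trans (norm_mulmx_le _ _))//.
  have wx : `|w x| <= `|w 0| + `|K| * `|M|.
    have := wK x 0; rewrite subr0 => wx0.
    have : `|w x| <= `|w x - w 0| + `|w 0|.
      by rewrite -[X in `|X| <= _](subrK (w 0)) ler_normD.
    have : K * `|x| <= `|K| * `|M|.
      rewrite (le_trans (ler_norm _))// normrM normr_id ler_wpM2l//.
      by rewrite (le_trans (AM _ Ax))// ler_norm.
    by move: wx0; lra.
  apply: (@le_lt_trans _ _ (B * r)).
    rewrite mulrAC; apply: ler_pM => //.
    by rewrite /B ler_wpDr ?mulr_ge0// ler_wpM2l.
  by rewrite (lt_le_trans rB)// ler_piMl ?invr_ge0// invf_le1// ler1n.
pose Z := [set x | Aj j x /\ ~ A (plane_pt w x t)].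
have AjZ : (lebesgue_outer (Aj j) <= lebesgue_outer Z)%E.
  apply: (@le_trans _ _ (lebesgue_outer ([set x | E x t] `|` Z))).
    apply: le_lebesgue_outer => x Ajx.
    have [Ax|nAx] := pselect (A (plane_pt w x t)); last by right.
    by left; split => //; case: Ajx.
  by rewrite (le_trans (outer_measureU2 _ _ _))//= [X in (X + _)%E]Et add0e.
have ZU : (lebesgue_outer Z <= k%:E * lebesgue_outer (U `\` A))%E.
  have h := @lebesgue_outer_expanding _ _ Z (plane_pt w ^~ t) 2.
  apply: le_trans (h _ _) _ => //.
    by move=> x y _ _; exact: plane_pt_expanding.
  rewrite lee_pmul2l ?lte_fin//.
  by apply: le_lebesgue_outer => _ [x [/tU Ux nAx] <-].
have : ((a / 2)%:E < k%:E * (a / (2 * k))%:E)%E.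
  rewrite (lt_le_trans Aja)// (le_trans AjZ)// (le_trans ZU)//.
  by rewrite lee_pmul2l ?lte_fin// ltW.
rewrite -EFinM lte_fin (_ : k * _ = a / 2) ?ltxx//.
by have := lt0r_neq0 k0 => ?; field.
Qed.

Lemma ae_plane_sections_null_converse (A : set 'rV[R]_n) : borel A ->
  lebesgue_outer [set x | A x /\ lebesgue_outer [set t | A (plane_pt w x t)] <> 0%E] = 0%E ->
  lebesgue_outer A = 0%E.
Proof.
move=> mA A0; pose B (k : nat) : set 'rV[R]_n := box (const_mx (- k%:R)) (const_mx k%:R).
rewrite -[A]setIT bigcup_box_setT setI_bigcupr.
apply: lebesgue_outer_null_bigcup => k.
apply: (@plane_sections_null_bounded _ k%:R).
- have mB : measurable (B k : set (rVborel R n)).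
    by apply: closed_measurable_rV; exact: box_closed.
  exact: (@measurableI _ (rVborel R n) A (B k) mA mB).
- move=> x [_ Bx]; apply: mx_norm_le => // i j; rewrite (ord1 i) ler_norml.
  by have := Bx j; rewrite !mxE.
- apply: lebesgue_outer_nullS A0 => x [[Ax _] nz]; split => // z; apply: nz.
  by apply: lebesgue_outer_nullS z => t [].
Qed.

End moving_planes_converse.

(** * Hausdorff null sets in a plane *)

Section euclidean_norm.
Context {R : realType} {n : nat}.
Implicit Types x y : 'rV[R]_n.

Lemma enormE x : enorm x = Num.sqrt (\sum_i x 0 i ^+ 2).
Proof. by rewrite /enorm /dotr; congr Num.sqrt; apply: eq_bigr => i _; rewrite expr2. Qed.

Lemma ler_norm_enorm x : `|x| <= enorm x.
Proof.
apply: mx_norm_le => [|i j]; first exact: sqrtr_ge0.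
rewrite (ord1 i) enormE -sqrtr_sqr ler_sqrt; last by rewrite sumr_ge0// => k _; rewrite sqr_ge0.
by rewrite (bigD1 j)//= lerDl sumr_ge0// => k _; rewrite sqr_ge0.
Qed.

Lemma enorm_le_norm x : enorm x <= n%:R * `|x|.
Proof.
have nx0 : 0 <= n%:R * `|x| by rewrite mulr_ge0.
rewrite enormE -[leRHS]ger0_norm// -sqrtr_sqr ler_sqrt ?sqr_ge0//.
rewrite (le_trans (y := \sum_(i < n) `|x| ^+ 2))//.
  by apply: ler_sum => i _; rewrite -real_normK ?num_real// lerXn2r ?nnegrE// ler_entry_norm.
rewrite sumr_const card_ord -[leLHS]mulr_natl exprMn ler_wpM2r ?sqr_ge0//.
by rewrite expr2 -natrM ler_nat; case: (n) => // k; rewrite leq_pmulr.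
Qed.

Lemma enorm0 : enorm (0 : 'rV[R]_n) = 0.
Proof. by apply/eqP; rewrite eq_le sqrtr_ge0 andbT (le_trans (enorm_le_norm _))// normr0 mulr0. Qed.

Lemma unit_ball_volume_gt0 : (0 < @unit_ball_volume R n)%E.
Proof.
have r0 : 0 < n.+1%:R^-1 :> R by rewrite invr_gt0.
apply: (@lt_le_trans _ _ (lebesgue_outer (cube (0 : 'rV[R]_n) n.+1%:R^-1))).
  by rewrite lebesgue_outer_cube ?(ltW r0)// lte_fin exprn_gt0// mulr_gt0.
apply: le_lebesgue_outer => x; rewrite cubeE ?(ltW r0)//= subr0 => xr.
rewrite (le_trans (enorm_le_norm _))// (le_trans (ler_wpM2l _ xr))//.
by rewrite ler_pdivrMr// mul1r ler_nat.
Qed.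

Lemma unit_ball_volume_lty : (@unit_ball_volume R n < +oo)%E.
Proof.
apply: (@le_lt_trans _ _ (lebesgue_outer (cube (0 : 'rV[R]_n) 1))).
  apply: le_lebesgue_outer => x /= x1; rewrite cubeE//= subr0.
  exact: le_trans (ler_norm_enorm _) x1.
by rewrite lebesgue_outer_cube// ltry.
Qed.

Lemma ediam_ge0 (E : set 'rV[R]_n) : E !=set0 -> (0%:E <= ediam E)%E.
Proof.
by move=> [x Ex]; apply: ereal_sup_ubound; exists x => //; exists x => //; rewrite subrr enorm0.
Qed.

End euclidean_norm.

Section hausdorff_bounds.
Context {R : realType} {n : nat} (m : nat).
Implicit Types E A : set 'rV[R]_n.
Local Open Scope ereal_scope.

Lemma unit_ball_volume_fin : @unit_ball_volume R m = (fine (@unit_ball_volume R m))%:E.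
Proof. by rewrite fineK// ge0_fin_numE ?unit_ball_volume_lty// ltW// unit_ball_volume_gt0. Qed.

Lemma fine_unit_ball_volume_gt0 : (0 < fine (@unit_ball_volume R m))%R.
Proof. by rewrite -lte_fin -unit_ball_volume_fin unit_ball_volume_gt0. Qed.

Lemma hausdorff_gauge_fin E (d : R) : E !=set0 -> ediam E <= d%:E ->
  exists q : R, [/\ (0 <= q <= d)%R, (forall x y, E x -> E y -> (enorm (x - y) <= q)%R) &
    hausdorff_gauge m E = (fine (@unit_ball_volume R m) * (q / 2) ^+ m)%:E].
Proof.
move=> E0 Ed; have d0 := ediam_ge0 E0.
have [q qE] : exists q, ediam E = q%:E.
  by exists (fine (ediam E)); rewrite fineK// ge0_fin_numE// (le_lt_trans Ed)// ltry.
exists q; split.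
- by rewrite -!lee_fin -qE d0 Ed.
- by move=> x y Ex Ey; rewrite -lee_fin -qE; apply: ereal_sup_ubound; exists x => //; exists y.
- rewrite /hausdorff_gauge; case: eqP => [E00|_]; first by case: E0 => x; rewrite E00.
  by rewrite unit_ball_volume_fin qE -EFinM -EFin_expe -EFinM.
Qed.

Lemma hausdorff_gauge_ge0 E : 0 <= hausdorff_gauge m E.
Proof.
rewrite /hausdorff_gauge; case: eqP => // /eqP /set0P E0.
rewrite mule_ge0// ?(ltW unit_ball_volume_gt0)//; apply: expe_ge0.
by rewrite mule_ge0 ?ediam_ge0// lee_fin.
Qed.

Lemma hausdorff_delta_ge0 d A : 0 <= hausdorff_delta m d A.
Proof.
apply: le_ereal_inf_tmp => _ [E _ <-]; apply: nneseries_ge0 => k _ _.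
exact: hausdorff_gauge_ge0.
Qed.

Lemma hausdorff_eq0P A : hausdorff m A = 0 <->
  forall d, (0 < d)%R -> hausdorff_delta m d A = 0.
Proof.
split=> [A0 d d0|Ad].
  apply/eqP; rewrite eq_le hausdorff_delta_ge0 andbT -A0.
  by apply: ereal_sup_ubound; exists d.
apply/eqP; rewrite eq_le; apply/andP; split.
  by apply: ub_ereal_sup => _ [d d0 <-]; rewrite Ad.
rewrite -(Ad 1%R ltr01); apply: ereal_sup_ubound; exists 1%R => //.
exact: ltr01.
Qed.

End hausdorff_bounds.

Section bilipschitz.
Context {R : realType} {n m : nat}.
Variables (Z : set 'rV[R]_m) (f : 'rV[R]_m -> 'rV[R]_n) (L : R).
Hypothesis L0 : 0 < L.
Local Open Scope ereal_scope.

Lemma hausdorff_lipschitz_null :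
  (forall s t, Z s -> Z t -> (`|f s - f t| <= L * `|s - t|)%R) ->
  lebesgue_outer Z = 0 -> hausdorff m (f @` Z) = 0.
Proof.
move=> fL Z0; apply/hausdorff_eq0P => d d0.
apply/eqP; rewrite eq_le hausdorff_delta_ge0 andbT.
apply/lee_addgt0Pr => e e0; rewrite add0e.
set o := fine (@unit_ball_volume R m).
have o0 : (0 < o)%R by exact: fine_unit_ball_volume_gt0.
pose N : R := (n%:R * L + 1)%R.
have N0 : (0 < N)%R by rewrite ltr_wpDl// mulr_ge0// ltW.
pose C : R := (o * (N / 2) ^+ m)%R.
have C0 : (0 < C)%R by rewrite mulr_gt0// exprn_gt0// divr_gt0.
have [||D [x [r [rd ZD sD]]]] := @small_cubes_cover R m Z (d / (2 * N)) (e / C)%:E.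
- by rewrite divr_gt0// mulr_gt0.
- by rewrite Z0 lte_fin divr_gt0.
have r0 k : (0 <= r k)%R by have /andP[/ltW] := rd k.
pose E k := if k \in D then f @` (Z `&` cube (x k) (r k)) else set0.
have Ed k y z : E k y -> E k z -> (enorm (y - z) <= N * (2 * r k))%R.
  rewrite /E; case: ifP => // _ [s [Zs sk] <-] [t [Zt tk] <-].
  rewrite (le_trans (enorm_le_norm _))//.
  have st : (`|s - t| <= 2 * r k)%R.
    move: sk tk; rewrite cubeE//= => sk tk.
    by rewrite (le_trans (ler_distD (x k) _ _))// mulr2n mulrDl mul1r lerD// distrC.
  have h := le_trans (fL _ _ Zs Zt) (ler_wpM2l (ltW L0) st).
  rewrite (le_trans (ler_wpM2l _ h))// mulrA ler_wpM2r ?mulr_ge0//.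
  by rewrite lerDl.
have Edd k : ediam (E k) <= d%:E.
  apply: ub_ereal_sup => _ [y Ey] [z Ez <-]; rewrite lee_fin (le_trans (Ed _ _ _ Ey Ez))//.
  have /andP[_ rk] := rd k.
  rewrite (le_trans (ler_wpM2l _ (ler_wpM2l _ rk)))// ?(ltW N0)//.
  have cancel (a b : R) : b != 0%R -> (b * (2 * (a / (2 * b))) = a)%R.
    by move=> ?; field.
  by rewrite cancel// gt_eqF.
apply: (@le_trans _ _ (\sum_(k <oo) hausdorff_gauge m (E k))).
  apply: ereal_inf_lbound; exists E => //; split => // _ [t Zt <-].
  by have [k Dk tk] := ZD _ Zt; exists k => //; rewrite /E mem_set//; exists t.
apply: (@le_trans _ _ (\sum_(k <oo) C%:E * (if k \in D then ((2 * r k) ^+ m)%:E else 0))).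
  apply: lee_nneseries => [k _ _|k _]; first exact: hausdorff_gauge_ge0.
  have [Ek0|/set0P Ek] := eqVneq (E k) set0.
    rewrite {1}/hausdorff_gauge Ek0 eqxx; apply: mule_ge0; first by rewrite lee_fin ltW.
    by case: ifP => // _; rewrite lee_fin exprn_ge0// mulr_ge0.
  have Dk : k \in D by move: Ek; rewrite /E; case: ifP => // _ [].
  have dk : ediam (E k) <= (N * (2 * r k))%:E.
    by apply: ub_ereal_sup => _ [y Ey] [z Ez <-]; rewrite lee_fin; exact: Ed Ey Ez.
  have [q [/andP[q0 qd] _ ->]] := hausdorff_gauge_fin m Ek dk.
  rewrite Dk -EFinM lee_fin /C -!mulrA ler_wpM2l ?(ltW o0)// -exprMn.
  rewrite lerXn2r ?nnegrE ?divr_ge0 ?mulr_ge0 ?(ltW N0)//.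
  by rewrite mulrAC ler_wpM2r.
rewrite nneseriesZl => [|k _]; last first.
  by case: ifP => // _; rewrite lee_fin exprn_ge0// mulr_ge0.
rewrite -(@nneseries_esum_cond R D (fun k => ((2 * r k) ^+ m)%:E)) => [|k]; last first.
  by rewrite lee_fin exprn_ge0// mulr_ge0.
rewrite (_ : e = C * (e / C))%R; last by rewrite mulrC divfK// gt_eqF.
rewrite [leRHS]EFinM; apply: lee_wpmul2l; first by rewrite lee_fin ltW.
exact: ltW.
Qed.

Lemma hausdorff_expanding_null :
  (forall s t, Z s -> Z t -> (`|s - t| <= L * `|f s - f t|)%R) ->
  hausdorff m (f @` Z) = 0 -> lebesgue_outer Z = 0.
Proof.
move=> fL /hausdorff_eq0P /(_ 1%R ltr01) H0.
apply/eqP; rewrite eq_le lebesgue_outer_ge0 andbT.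
apply/lee_addgt0Pr => e e0; rewrite add0e.
set o := fine (@unit_ball_volume R m) in H0 *.
have o0 : (0 < o)%R by exact: fine_unit_ball_volume_gt0.
pose C : R := ((4 * L) ^+ m / o)%R.
have C0 : (0 < C)%R by rewrite divr_gt0// exprn_gt0// mulr_gt0.
have : hausdorff_delta m 1 (f @` Z) < (e / C)%:E by rewrite H0 lte_fin divr_gt0.
move=> /ereal_inf_lt[_ [E [ZE E1] <-]] sE.
pose F k := Z `&` f @^-1` (E k).
apply: (@le_trans _ _ (lebesgue_outer (\bigcup_k F k))).
  apply: le_lebesgue_outer => t Zt; have [|k _ Ek] := ZE (f t); first by exists t.
  by exists k.
rewrite (le_trans (lebesgue_outer_sigma_subadditive _))//.
apply: (@le_trans _ _ (\sum_(k <oo) C%:E * hausdorff_gauge m (E k))).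
  apply: lee_nneseries => [k _ _|k _]; first exact: lebesgue_outer_ge0.
  have [->|/set0P [t [Zt Et]]] := eqVneq (F k) set0.
    rewrite lebesgue_outer0; apply: mule_ge0; first by rewrite lee_fin ltW.
    exact: hausdorff_gauge_ge0.
  have [|q [/andP[q0 _] Eq ->]] := hausdorff_gauge_fin m _ (E1 k); first by exists (f t).
  apply: (@le_trans _ _ (lebesgue_outer (cube t (L * q)))).
    apply: le_lebesgue_outer => s [Zs Es]; rewrite cubeE ?mulr_ge0 ?(ltW L0)//=.
    rewrite (le_trans (fL _ _ Zs Zt))// ler_wpM2l ?(ltW L0)//.
    by rewrite (le_trans (ler_norm_enorm _))// Eq.
  rewrite lebesgue_outer_cube ?mulr_ge0 ?(ltW L0)// -EFinM lee_fin /C.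
  rewrite -/o [leRHS]mulrA divfK ?gt_eqF// -exprMn (_ : 2 * (L * q) = 4 * L * (q / 2))%R//.
  by field.
rewrite nneseriesZl => [|k _]; last exact: hausdorff_gauge_ge0.
rewrite (_ : e = C * (e / C))%R; last by rewrite mulrC divfK// gt_eqF.
rewrite [leRHS]EFinM; apply: lee_wpmul2l; first by rewrite lee_fin ltW.
exact: ltW.
Qed.

End bilipschitz.

Lemma hausdorff_plane_null (R : realType) (n m : nat) (A : set 'rV[R]_n) (x : 'rV[R]_n)
    (B : 'M[R]_(m, n)) : row_free B ->
  hausdorff m (A `&` [set x + t *m B | t in [set: 'rV[R]_m]]) = 0%E <->
  lebesgue_outer [set t | A (x + t *m B)] = 0%E.
Proof.
move=> Bfree; pose Z := [set t | A (x + t *m B)]; pose f t := x + t *m B.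
have -> : A `&` [set x + t *m B | t in [set: 'rV[R]_m]] = f @` Z.
  apply/seteqP; split=> [y [Ay [t _ tE]]|_ [t At <-]]; last by split => //; exists t.
  by exists t; rewrite /Z/= ?tE.
have fB s t : f s - f t = (s - t) *m B by rewrite /f mulmxBl opprD addrACA subrr add0r.
pose L := m%:R * `|B| + n%:R * `|pinvmx B| + 1.
have h1 : 0 <= m%:R * `|B| by rewrite mulr_ge0.
have h2 : 0 <= n%:R * `|pinvmx B| by rewrite mulr_ge0.
have L0 : 0 < L by rewrite ltr_wpDl// addr_ge0.
split; [apply: (hausdorff_expanding_null L0)|apply: (hausdorff_lipschitz_null L0)] => s t _ _.
  rewrite fB -[X in `|X| <= _](mulmxKp Bfree) (le_trans (norm_mulmx_le _ _))//.
  by rewrite mulrAC ler_wpM2r// /L; lra.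
rewrite fB (le_trans (norm_mulmx_le _ _))// mulrAC ler_wpM2r// /L; lra.
Qed.

(** * Lipschitz frames of a field of planes *)

Section lipschitz_extension.
Context {R : realType} {n : nat} (S : set 'rV[R]_n) (L : R).

(* McShane's extension: the lower envelope of the cones [f s + L `|x - s|]. *)
Lemma lipschitz_extension (f : 'rV[R]_n -> R) :
  (forall x y, S x -> S y -> `|f x - f y| <= L * `|x - y|) -> 0 <= L ->
  exists2 g : 'rV[R]_n -> R, (forall x y, `|g x - g y| <= L * `|x - y|) &
    forall x, S x -> g x = f x.
Proof.
move=> fL L0; have [[s0 Ss0]|S0] := pselect (S !=set0); last first.
  exists (fun=> 0) => [x y|x Sx]; first by rewrite subrr normr0 mulr_ge0.
  by exfalso; apply: S0; exists x.
pose cone x := [set f s + L * `|x - s| | s in S].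
have cone0 x : cone x !=set0 by exists (f s0 + L * `|x - s0|), s0.
have conelb x : has_lbound (cone x).
  exists (f s0 - L * `|x - s0|) => _ [s Ss <-].
  have := fL _ _ Ss0 Ss; have := ler_norm (f s0 - f s).
  have := ler_wpM2l L0 (ler_distD x s0 s); rewrite mulrDr (distrC s0 x); lra.
pose g x := inf (cone x).
have gle x s : S s -> g x <= f s + L * `|x - s|.
  by move=> Ss; apply: ge_inf => //; exists s.
have gL x y : g x - g y <= L * `|x - y|.
  rewrite lerBlDr -lerBlDl; apply: lb_le_inf => // _ [s Ss <-].
  have := gle x s Ss; have := ler_wpM2l L0 (ler_distD y x s); rewrite mulrDr; lra.
exists g => [x y|x Sx].
  by rewrite ler_norml gL andbT lerNl opprB distrC gL.
apply/eqP; rewrite eq_le; apply/andP; split.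
  by have := gle x x Sx; rewrite subrr normr0 mulr0 addr0.
apply: lb_le_inf => // _ [s Ss <-].
by have := fL _ _ Sx Ss; have := ler_norm (f x - f s); lra.
Qed.

Lemma lipschitz_extension_mx m p (f : 'rV[R]_n -> 'M[R]_(m, p)) :
  (forall x y, S x -> S y -> `|f x - f y| <= L * `|x - y|) -> 0 <= L ->
  exists2 g : 'rV[R]_n -> 'M[R]_(m, p), (forall x y, `|g x - g y| <= L * `|x - y|) &
    forall x, S x -> g x = f x.
Proof.
move=> fL L0.
have /choice[g gP] (jk : 'I_m * 'I_p) : exists g : 'rV[R]_n -> R,
    (forall x y, `|g x - g y| <= L * `|x - y|) /\
    (forall x, S x -> g x = f x jk.1 jk.2).
  have [|//|g] := @lipschitz_extension (fun x => f x jk.1 jk.2).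
    move=> x y Sx Sy; rewrite (le_trans _ (fL _ _ Sx Sy))//.
    by have := ler_entry_norm (f x - f y) jk.1 jk.2; rewrite !mxE.
  by exists g.
exists (fun x => \matrix_(j, k) g (j, k) x) => [x y|x Sx].
  apply: mx_norm_le => [|j k]; first by rewrite mulr_ge0.
  by rewrite !mxE; exact: (gP (j, k)).1.
by apply/matrixP => j k; rewrite mxE; exact: (gP (j, k)).2.
Qed.

End lipschitz_extension.

Section projections.
Context {R : realType} {n : nat}.
Implicit Types W : {vspace 'rV[R]_n}.

Lemma dotr_eq0 (v : 'rV[R]_n) : dotr v v = 0 -> v = 0.
Proof.
move=> vv; apply/eqP; rewrite -normr_le0 (le_trans (ler_norm_enorm _))//.
by rewrite /enorm vv sqrtr0.
Qed.

Lemma orthproj_id W v : v \in W -> orthproj W v = v.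
Proof.
apply: daddv_pi_id; apply/eqP; rewrite -subv0; apply/subvP => u.
rewrite memv_cap memv0 => /andP[Wu /mem_orthovP /(_ _ Wu)] uu.
by apply/eqP; exact: dotr_eq0.
Qed.

Lemma orthproj_in W v : orthproj W v \in W. Proof. exact: memv_pi. Qed.

Lemma norm_lfun_le_opnorm (f : 'End('rV[R]_n)) u :
  enorm u <= 1 -> `|f u| <= opnorm f.
Proof.
move=> u1; rewrite (le_trans (ler_norm_enorm _))//.
apply: ub_le_sup; last by exists u.
exists (n%:R * (n%:R * 1 * `|lin1_mx f|)) => _ [v v1 <-].
rewrite (le_trans (enorm_le_norm _))// ler_wpM2l// -mul_rV_lin1.
rewrite (le_trans (norm_mulmx_le _ _))// ler_wpM2r// ler_wpM2l//.
exact: le_trans (ler_norm_enorm _) v1.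
Qed.

Lemma enorm_delta i : enorm (delta_mx 0 i : 'rV[R]_n) = 1.
Proof.
rewrite enormE (bigD1 i)//= big1 => [|j ji]; last by rewrite mxE/= (negPf ji) expr0n.
by rewrite addr0 mxE !eqxx expr1n sqrtr1.
Qed.

Lemma dim_row_free m W (B : 'M[R]_(m, n)) : row_free B ->
  (forall t : 'rV_m, t *m B \in W) ->
  \dim W = m <-> (forall v, v \in W -> exists t, v = t *m B).
Proof.
move=> Bfree BW; pose g : 'Hom('rV[R]_m, 'rV[R]_n) := linfun (mulmxr B).
have gE t : g t = t *m B by rewrite lfunE.
have dg : \dim (limg g) = m.
  rewrite limg_dim_eq; first by rewrite dimvf dim_matrix; exact: mul1n.
  apply/eqP; rewrite -subv0; apply/subvP => t.
  rewrite memv_cap memv_ker gE memv0 => /andP[_ /eqP tB].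
  by rewrite -(mulmxKp Bfree t) tB mul0mx.
have gW : (limg g <= W)%VS by apply/subvP => _ /memv_imgP[t _ ->]; rewrite gE.
split=> [Wm v|span].
  have /eqP <- : (limg g == W)%VS by rewrite eqEdim gW dg Wm/=.
  by move=> /memv_imgP[t _ ->]; exists t; rewrite gE.
rewrite -dg; congr (\dim _); apply/eqP; rewrite eqEsubv gW andbT.
by apply/subvP => v /span[t ->]; rewrite -gE memv_img// memvf.
Qed.

Lemma orthproj_frame m W : \dim W = m -> exists I : 'I_m -> 'I_n,
  row_free (\matrix_j orthproj W (delta_mx 0 (I j))).
Proof.
move=> Wm; pose P := lin1_mx (orthproj W).
have PE t : t *m P = orthproj W t by rewrite mul_rV_lin1.
have rP : \rank P = m.
  rewrite -Wm; apply/esym/(dim_row_free (maxrowsub_free P)) => [t|v Wv].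
    have /submxP[u ->] : (t *m rowsub (maxrankfun P) P <= P)%MS.
      by rewrite -(eq_maxrowsub P) submxMl.
    by rewrite PE orthproj_in.
  apply/submxP; rewrite (eq_maxrowsub P) -(orthproj_id Wv) -PE.
  exact: submxMl.
have : exists I : 'I_(\rank P) -> 'I_n, row_free (rowsub I P).
  by exists (maxrankfun P); exact: maxrowsub_free.
rewrite rP => -[I Ifree]; exists I; congr (row_free _) : Ifree.
by apply/matrixP => j k; rewrite !mxE.
Qed.

Lemma affine_atE m x W (B : 'M[R]_(m, n)) : \dim W = m -> row_free B ->
  (forall t : 'rV_m, t *m B \in W) ->
  affine_at x W = [set x + t *m B | t in [set: 'rV[R]_m]].
Proof.
move=> Wm Bfree BW; have h := (dim_row_free Bfree BW).1 Wm.
apply/seteqP; split=> [_ [v /= Wv <-]|_ [t _ <-]].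
  by have [t ->] := h _ Wv; exists t.
by exists (t *m B) => //; exact: BW.
Qed.

End projections.

Lemma row_free_borel (R : realType) (n m : nat) (w : 'rV[R]_n -> 'M[R]_(m, n)) :
  (forall i k, continuous (fun x => w x i k)) -> borel [set x | row_free (w x)].
Proof.
move=> wc.
rewrite (_ : [set x | _] = \bigcup_(g : {ffun 'I_m -> 'I_n})
    [set x | \det (colsub g (w x)) != 0]).
  apply: (@countable_bigcup_measurable _ (rVborel R n)) => g _.
  rewrite (_ : [set x | _] =
    ~` ((fun x : rVborel R n => \det (colsub g (w x))) @^-1` [set 0])); last first.
    by apply/seteqP; split=> x /=; [move/eqP|move=> ?; exact/eqP].
  apply: measurableC.
  apply: (@measurable_preimage_setT _ _ (rVborel R n) (measurableTypeR R)
    (fun x => \det (colsub g (w x))));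
    last exact: measurable_set1.
  rewrite /determinant; apply: measurable_sum => s; apply: measurable_funM => //.
  apply: measurable_prod => i _; under eq_fun do rewrite !mxE.
  exact: continuous_measurable_rV.
apply/seteqP; split=> [x /= xfree|x [g _ /= dg]].
  have full : row_full (w x)^T by rewrite /row_full mxrank_tr.
  exists (fullrankfun full) => //=.
  have := fullrowsub_unit full; rewrite -unitmx_tr unitmxE unitfE.
  by congr (\det _ != 0); apply/matrixP => i j; rewrite !mxE.
have dE : colsub g (w x) = w x *m colsub g 1%:M by rewrite mulmx_colsub mulmx1.
rewrite /row_free eqn_leq rank_leq_row/=.
rewrite -[X in (X <= _)%N](@mxrank_unit _ _ (colsub g (w x))) ?unitmxE ?unitfE//.
by rewrite [in X in (X <= _)%N]dE mxrankM_maxl.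
Qed.

Lemma glipschitz_frames (R : realType) (n m : nat) (S : set 'rV[R]_n)
    (W0 : 'rV[R]_n -> {vspace 'rV[R]_n}) :
  (forall x, S x -> grassmannian m (W0 x)) -> glipschitz S W0 ->
  exists (w : {ffun 'I_m -> 'I_n} -> 'rV[R]_n -> 'M[R]_(m, n)) (K : R),
    [/\ forall I x y, `|w I x - w I y| <= K * `|x - y|,
        forall x, S x -> exists I, row_free (w I x) &
        forall I x, S x -> row_free (w I x) ->
          affine_at x (W0 x) = [set x + t *m w I x | t in [set: 'rV[R]_m]]].
Proof.
move=> W0m [K W0K].
pose f (I : {ffun 'I_m -> 'I_n}) x : 'M[R]_(m, n) :=
  \matrix_j orthproj (W0 x) (delta_mx 0 (I j)).
pose L := `|K| * n%:R; have L0 : 0 <= L by rewrite mulr_ge0.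
have fL I x y : S x -> S y -> `|f I x - f I y| <= L * `|x - y|.
  move=> Sx Sy; apply: mx_norm_le => [|j k]; first by rewrite mulr_ge0.
  rewrite !mxE.
  have := ler_entry_norm ((orthproj (W0 x) - orthproj (W0 y)) (delta_mx 0 (I j))) 0 k.
  rewrite !lfunE/= lfunE/= !mxE => /le_trans; apply.
  have h := @norm_lfun_le_opnorm _ _ (orthproj (W0 x) - orthproj (W0 y))
    (delta_mx 0 (I j)).
  rewrite (le_trans _ (le_trans (h _) (le_trans (W0K _ _ Sx Sy) _)))//.
  - by rewrite !lfunE/= lfunE.
  - by rewrite enorm_delta.
  - rewrite (le_trans (ler_wpM2r (sqrtr_ge0 _) (ler_norm K)))// /L -mulrA.
    by rewrite ler_wpM2l// enorm_le_norm.
have /choice[w wP] I : exists w : 'rV[R]_n -> 'M[R]_(m, n),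
    (forall x y, `|w x - w y| <= L * `|x - y|) /\ (forall x, S x -> w x = f I x).
  by have [w] := lipschitz_extension_mx (fL I) L0; exists w.
exists w, L; split=> [I|x Sx|I x Sx].
- exact: (wP I).1.
- have [I Ifree] := orthproj_frame (W0m _ Sx); exists (finfun I).
  rewrite (wP _).2//; congr (row_free _) : Ifree.
  by apply/matrixP => j k; rewrite !mxE ffunE.
- rewrite (wP I).2// => ffree; apply: affine_atE => // [|t]; first exact: W0m.
  rewrite mulmx_sum_row memv_suml// => j _; rewrite memvZ// rowK.
  exact: orthproj_in.
Qed.

Theorem theorem8p1 (R : realType) (n m : nat) (hm : (1 <= m <= n - 1)%N)
    (S : set 'rV[R]_n) (W0 : 'rV[R]_n -> {vspace 'rV[R]_n})
    (hW0 : forall x, S x -> grassmannian m (W0 x))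
    (hlip : glipschitz S W0)
    (A : set 'rV[R]_n) (hAS : A `<=` S) (hA : borel A) :
  [<-> lebesgue_outer A = 0%E;
       ae_on A (fun x => hausdorff m (A `&` affine_at x (W0 x)) = 0%E);
       ae_on S (fun x => hausdorff m (A `&` affine_at x (W0 x)) = 0%E)].
Proof.
have [w [K [wK wfree wW]]] := glipschitz_frames hW0 hlip.
have H0 I x : S x -> row_free (w I x) ->
    hausdorff m (A `&` affine_at x (W0 x)) = 0%E <->
    lebesgue_outer [set t | A (plane_pt (w I) x t)] = 0%E.
  by move=> Sx xfree; rewrite (wW _ _ Sx xfree); exact: hausdorff_plane_null.
have null_ae_S : lebesgue_outer A = 0%E ->
    ae_on S (fun x => hausdorff m (A `&` affine_at x (W0 x)) = 0%E).
  move=> A0; apply: (@lebesgue_outer_nullS _ _ _ (\bigcup_I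
    [set x | lebesgue_outer [set t | A (plane_pt (w I) x t)] <> 0%E])); last first.
    apply: lebesgue_outer_null_countable => I.
    exact: (ae_plane_sections_null (wK I) hA A0).
  move=> x [Sx xA]; have [I Ifree] := wfree x Sx; exists I => //= h.
  by apply: xA; exact/(H0 I).
have ae_S_A : ae_on S (fun x => hausdorff m (A `&` affine_at x (W0 x)) = 0%E) ->
    ae_on A (fun x => hausdorff m (A `&` affine_at x (W0 x)) = 0%E).
  by apply: lebesgue_outer_nullS => x [/hAS Sx xA].
have ae_A_null : ae_on A (fun x => hausdorff m (A `&` affine_at x (W0 x)) = 0%E) ->
    lebesgue_outer A = 0%E.
  move=> aeA; pose B I := A `&` [set x | row_free (w I x)].
  rewrite (_ : A = \bigcup_I B I); last first.
    apply/seteqP; split=> [x Ax|x [I _ []]//].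
    by have [I Ifree] := wfree x (hAS _ Ax); exists I.
  apply: lebesgue_outer_null_countable => I.
  apply: (ae_plane_sections_null_converse (wK I)).
    apply: (@measurableI _ (rVborel R n)) => //; apply: row_free_borel => i k.
    exact: lipschitz_rV_continuous (entry_lipschitz (wK I) i k).
  apply: lebesgue_outer_nullS aeA => x [[Ax xfree] xB]; split => // xA; apply: xB.
  have := (H0 _ _ (hAS _ Ax) xfree).1 xA.
  by apply: lebesgue_outer_nullS => t [].
tfae; [by move=> /null_ae_S /ae_S_A|by move=> /ae_A_null /null_ae_S|].
by move=> /ae_S_A /ae_A_null.
Qed.
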